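(* Let $d,n$ be positive integers. Then $$\dim_{\mathbb{C}(q)}\bigl(\mathbb{C}(q){\rm FTL}_{d,n}(q)\bigr)=\sum_{\mu\in{\rm Comp}_d(n)}\left(\frac{n!}{\mu_1!\mu_2!\cdots\mu_d!}\right)^2C_{\mu_1}C_{\mu_2}\cdots C_{\mu_d}.$$
   Context: Let $q$ be an indeterminate. The Yokonuma--Hecke algebra ${\rm Y}_{d,n}(q)$ is the associative unital $\mathbb{C}[q,q^{-1}]$-algebra generated by $g_1,\dots,g_{n-1},t_1,\dots,t_n$ with relations: $g_ig_j=g_jg_i$ if $|i-j|>1$; $g_ig_{i+1}g_i=g_{i+1}g_ig_{i+1}$ for $1\le i\le n-2$; $t_it_j=t_jt_i$; $t_jg_i=g_it_{s_i(j)}$ where $s_i=(i,i+1)\in\mathfrak{S}_n$; $t_j^d=1$; and $g_i^2=q+(q-1)e_ig_i$, where $e_i=\frac1d\sum_{s=0}^{d-1}t_i^st_{i+1}^{-s}$. Framisation of the Temperley--Lieb algebra: ${\rm FTL}_{d,n}(q)={\rm Y}_{d,n}(q)/I_{d,n}$, where $I_{d,n}$ is the two-sided ideal generated by $e_1e_2\,g_{1,2}$ with $g_{1,2}=1+g_1+g_2+g_1g_2+g_2g_1+g_1g_2g_1$ (and $I_{d,n}=\{0\}$ if $n\le 2$). $\mathbb{C}(q){\rm FTL}_{d,n}(q):=\mathbb{C}(q)\otimes_{\mathbb{C}[q,q^{-1}]}{\rm FTL}_{d,n}(q)$. ${\rm Comp}_d(n)$ is the set of $d$-tuples $\mu=(\mu_1,\dots,\mu_d)$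 of non-negative integers with $\mu_1+\cdots+\mu_d=n$. $C_m=\frac{1}{m+1}\binom{2m}{m}$ is the $m$-th Catalan number (so $C_0=1$). *)

(* Defs.v *)
From HB Require Import structures.
From mathcomp Require Import all_boot all_order all_algebra fraction finmap perm.
From mathcomp Require Import ring_quotient generic_quotient.
From mathcomp Require Import boolp.
From mathcomp Require Import xfinmap monalg.

Set Implicit Arguments.
Unset Strict Implicit.
Unset Printing Implicit Defensive.

Import GRing.Theory.

Local Open Scope ring_scope.
Local Open Scope quotient_scope.

Inductive ideal_gen (B : pzRingType) (S : B -> Prop) : B -> Prop :=
| Ideal_gen x : S x -> ideal_gen S x
| Ideal_0 : ideal_gen S 0
| Ideal_sub x y : ideal_gen S x -> ideal_gen S y -> ideal_gen S (x - y)
| Ideal_mull a x : ideal_gen S x -> ideal_gen S (a * x)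
| Ideal_mulr x a : ideal_gen S x -> ideal_gen S (x * a).

Section IdealPred.
Variables (B : pzRingType) (S : B -> Prop).

Definition ideal_pred : {pred B} := fun x => `[< ideal_gen S x >].

Fact ideal_predP x : reflect (ideal_gen S x) (x \in ideal_pred).
Proof. exact: asboolP. Qed.

Fact ideal_pred_zmod_closed : zmod_closed ideal_pred.
Proof.
split; first by apply/asboolP; apply: Ideal_0.
by move=> x y /asboolP Ix /asboolP Iy; apply/asboolP; apply: Ideal_sub.
Qed.

HB.instance Definition _ :=
  GRing.isZmodClosed.Build B ideal_pred ideal_pred_zmod_closed.

End IdealPred.

Section QuotientRing.
Variables (B : pzRingType) (S : B -> Prop).

(* B / (S); it may be the zero ring, hence pzRingType. *)
Definition quotRing := Quotient.quot (ideal_pred S).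

HB.instance Definition _ := Choice.on quotRing.
HB.instance Definition _ := GRing.Zmodule.on quotRing.

Definition quot_pi (x : B) : quotRing := \pi_(Quotient.quot (ideal_pred S)) x.

Let rep (u : quotRing) : B := repr (u : Quotient.quot (ideal_pred S)).

Fact quot_eqP (x y : B) : quot_pi x = quot_pi y <-> ideal_gen S (x - y).
Proof.
have E : (quot_pi x == quot_pi y) = ((x - y) \in ideal_pred S).
  by rewrite Quotient.idealrBE.
split=> [/eqP|h]; first by rewrite E => /ideal_predP.
by apply/eqP; rewrite E; apply/ideal_predP.
Qed.

Fact quot_repK u : quot_pi (rep u) = u.
Proof. exact: reprK. Qed.

Fact quot_surj (u : quotRing) : exists x, quot_pi x = u.
Proof. by exists (rep u); exact: quot_repK. Qed.

Fact quot_pi_is_zmod_morphism : zmod_morphism quot_pi.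
Proof. exact: (raddfB (\pi_(Quotient.quot (ideal_pred S)))). Qed.

HB.instance Definition _ :=
  GRing.isZmodMorphism.Build B quotRing quot_pi quot_pi_is_zmod_morphism.

Definition quot_mul (u v : quotRing) : quotRing := quot_pi (rep u * rep v).

Fact quot_pi_mul (x y : B) : quot_pi (x * y) = quot_mul (quot_pi x) (quot_pi y).
Proof.
have h z : ideal_gen S (z - rep (quot_pi z)) by apply/quot_eqP; rewrite quot_repK.
apply/quot_eqP; set x' := rep _; set y' := rep _.
have -> : x * y - x' * y' = (x - x') * y - (- x') * (y - y').
  by rewrite mulNr opprK mulrBr mulrBl addrA subrK.
by apply: Ideal_sub; [apply: Ideal_mulr | apply: Ideal_mull].
Qed.

Fact quot_mulA : associative quot_mul.
Proof.
move=> u v w; have [x <-] := quot_surj u; have [y <-] := quot_surj v.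
by have [z <-] := quot_surj w; rewrite -!quot_pi_mul mulrA.
Qed.

Fact quot_mul1 : left_id (quot_pi 1) quot_mul.
Proof. by move=> u; have [x <-] := quot_surj u; rewrite -quot_pi_mul mul1r. Qed.

Fact quot_mulr1 : right_id (quot_pi 1) quot_mul.
Proof. by move=> u; have [x <-] := quot_surj u; rewrite -quot_pi_mul mulr1. Qed.

Fact quot_mulDl : left_distributive quot_mul +%R.
Proof.
move=> u v w; have [x <-] := quot_surj u; have [y <-] := quot_surj v.
by have [z <-] := quot_surj w; rewrite -raddfD -!quot_pi_mul mulrDl raddfD.
Qed.

Fact quot_mulDr : right_distributive quot_mul +%R.
Proof.
move=> u v w; have [x <-] := quot_surj u; have [y <-] := quot_surj v.
by have [z <-] := quot_surj w; rewrite -raddfD -!quot_pi_mul mulrDr raddfD.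
Qed.

HB.instance Definition _ := GRing.Zmodule_isPzRing.Build quotRing
  quot_mulA quot_mul1 quot_mulr1 quot_mulDl quot_mulDr.

Fact quot_pi_is_monoid_morphism : monoid_morphism quot_pi.
Proof. by split=> // x y; exact: quot_pi_mul. Qed.

HB.instance Definition _ :=
  GRing.isMonoidMorphism.Build B quotRing quot_pi quot_pi_is_monoid_morphism.

End QuotientRing.

Section ExtensionOfScalars.
Variables (A K : comNzRingType) (f : {rmorphism A -> K}) (M : lmodType A).

(* The free abelian group on the set K * M. *)
Local Notation Z := {malg int[(K * M)%type]}.
Local Notation "k '\ox' m" := (<< (k, m) >> : Z) (at level 30).

Inductive tensor_rel : Z -> Prop :=
| Tensor_addl k k' m :
    tensor_rel ((k + k') \ox m - (k \ox m + k' \ox m))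
| Tensor_addr k m m' :
    tensor_rel (k \ox (m + m') - (k \ox m + k \ox m'))
| Tensor_bal k a m :
    tensor_rel ((k * f a) \ox m - k \ox (a *: m))
| Tensor_0 : tensor_rel 0
| Tensor_sub x y : tensor_rel x -> tensor_rel y -> tensor_rel (x - y).

Definition tensor_pred : {pred Z} := fun x => `[< tensor_rel x >].

Fact tensor_predP x : reflect (tensor_rel x) (x \in tensor_pred).
Proof. exact: asboolP. Qed.

Fact tensor_pred_zmod_closed : zmod_closed tensor_pred.
Proof.
split; first by apply/asboolP; apply: Tensor_0.
by move=> x y /asboolP Ix /asboolP Iy; apply/asboolP; apply: Tensor_sub.
Qed.

HB.instance Definition _ :=
  GRing.isZmodClosed.Build Z tensor_pred tensor_pred_zmod_closed.

(* K \otimes_A M, where A acts on K through f. *)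
Definition tensor := Quotient.quot tensor_pred.

HB.instance Definition _ := Choice.on tensor.
HB.instance Definition _ := GRing.Zmodule.on tensor.

Definition tensor_pi (x : Z) : tensor := \pi_(Quotient.quot tensor_pred) x.

Local Notation pi := tensor_pi.

Fact tensor_eqP (x y : Z) : pi x = pi y <-> tensor_rel (x - y).
Proof.
have E : (pi x == pi y) = ((x - y) \in tensor_pred) by rewrite Quotient.idealrBE.
split=> [/eqP|h]; first by rewrite E => /tensor_predP.
by apply/eqP; rewrite E; apply/tensor_predP.
Qed.

Fact tensor_surj (u : tensor) : exists x, pi x = u.
Proof. by exists (repr (u : Quotient.quot tensor_pred)); exact: reprK. Qed.

Fact tensor_piD (x y : Z) : pi (x + y) = pi x + pi y.
Proof. exact: (raddfD (\pi_(Quotient.quot tensor_pred))). Qed.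

(* The additive extension of c (k \otimes m) = (c k) \otimes m. *)
Definition tensor_act (c : K) (x : Z) : Z :=
  \sum_(p <- msupp x) << x@_p *g (c * p.1, p.2) >>.

Fact tensor_actEw c (E : {fset (K * M)%type}) x : (msupp x `<=` E)%fset ->
  tensor_act c x = \sum_(p <- E) << x@_p *g (c * p.1, p.2) >>.
Proof.
move=> le; rewrite [LHS](big_fset_incl _ le) //= => p _ /mcoeff_outdom ->.
by rewrite monalgU0.
Qed.

Fact tensor_act_is_zmod_morphism c : zmod_morphism (tensor_act c).
Proof.
move=> x y; pose E := (msupp x `|` (msupp y `|` msupp (x - y)))%fset.
rewrite !(@tensor_actEw c E) ?fsubsetUl //; first last.
- by apply: fsubset_trans (fsubsetUr _ _); apply: fsubsetUr.
- by apply: fsubset_trans (fsubsetUr _ _); apply: fsubsetUl.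
by rewrite -sumrB; apply: eq_bigr => p _; rewrite mcoeffB monalgUB.
Qed.

HB.instance Definition _ c :=
  GRing.isZmodMorphism.Build Z Z (tensor_act c) (tensor_act_is_zmod_morphism c).

Fact tensor_actU c (z : int) p :
  tensor_act c << z *g p >> = << z *g (c * p.1, p.2) >>.
Proof.
rewrite (@tensor_actEw c [fset p]%fset) ?msuppU_le //.
by rewrite big_seq_fset1 mcoeffUU.
Qed.

Fact tensor_rel_act c x : tensor_rel x -> tensor_rel (tensor_act c x).
Proof.
elim=> [k k' m|k m m'|k a m||x1 y1 _ Ix _ Iy].
- by rewrite raddfB raddfD /= !tensor_actU /= mulrDr; apply: Tensor_addl.
- by rewrite raddfB raddfD /= !tensor_actU /=; apply: Tensor_addr.
- by rewrite raddfB /= !tensor_actU /= mulrA; apply: Tensor_bal.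
- by rewrite raddf0; apply: Tensor_0.
- by rewrite raddfB; apply: Tensor_sub.
Qed.

Definition tensor_scale (c : K) (u : tensor) : tensor :=
  pi (tensor_act c (repr (u : Quotient.quot tensor_pred))).

Fact tensor_piZ_def c x : pi (tensor_act c x) = tensor_scale c (pi x).
Proof.
apply/tensor_eqP; rewrite -raddfB; apply: tensor_rel_act.
by apply/tensor_eqP; rewrite /tensor_pi reprK.
Qed.

Fact tensor_scaleA a b u :
  tensor_scale a (tensor_scale b u) = tensor_scale (a * b) u.
Proof.
have [x <-] := tensor_surj u; rewrite -!tensor_piZ_def; congr pi.
rewrite [x]monalgE (raddf_sum (tensor_act b)) (raddf_sum (tensor_act a)).
rewrite (raddf_sum (tensor_act (a * b))); apply: eq_bigr => p _.
by rewrite /= !tensor_actU /= mulrA.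
Qed.

Fact tensor_scale1 : left_id 1 tensor_scale.
Proof.
move=> u; have [x <-] := tensor_surj u; rewrite -!tensor_piZ_def; congr pi.
rewrite [RHS]monalgE; apply: eq_bigr => p _.
by rewrite mul1r -surjective_pairing.
Qed.

Fact tensor_scaleDr : right_distributive tensor_scale +%R.
Proof.
move=> c u v; have [x <-] := tensor_surj u; have [y <-] := tensor_surj v.
by rewrite -tensor_piD -!tensor_piZ_def raddfD tensor_piD.
Qed.

Fact tensor_scaleDl u : {morph tensor_scale^~ u : a b / a + b}.
Proof.
move=> a b; have [x <-] := tensor_surj u.
rewrite -!tensor_piZ_def -tensor_piD; apply/tensor_eqP.
rewrite [x]monalgE !raddf_sum -big_split -sumrB /=; apply/tensor_predP.
apply: rpred_sum => p _.
rewrite !tensor_actU /= mulrDl; move: (x@_p) => z.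
have U (q : K * M) : (<< z *g q >> : Z) = << q >> *~ z by rewrite -raddfMz /= intz.
have D (v w : Z) : (v + w) *~ z = v *~ z + w *~ z by exact: mulrzDl.
have /tensor_predP/(rpredMz z) := Tensor_addl (a * p.1) (b * p.1) p.2.
by rewrite mulrzBl D -!U.
Qed.

HB.instance Definition _ := GRing.Zmodule_isLmodule.Build K tensor
  tensor_scaleA tensor_scale1 tensor_scaleDr tensor_scaleDl.

End ExtensionOfScalars.

Section Laurent.
Variable C : fieldType.

Definition ratfun := {fraction {poly C}}.

HB.instance Definition _ := GRing.Field.on ratfun.

Definition ratfun_of_poly (p : {poly C}) : ratfun := FracField.tofrac p.

HB.instance Definition _ :=
  GRing.RMorphism.copy ratfun_of_poly (@FracField.tofrac {poly C}).

(* C[q,q^-1], realised inside C(q) as the set of all p / q^k. *)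
Definition laurent_pred : {pred ratfun} :=
  fun x => `[< exists (p : {poly C}) (k : nat),
                 x * ratfun_of_poly 'X ^+ k = ratfun_of_poly p >].

Fact laurent_subring_closed : subring_closed laurent_pred.
Proof.
split.
- by apply/asboolP; exists 1, 0; rewrite expr0 mulr1 rmorph1.
- move=> x y /asboolP[p [k hx]] /asboolP[p' [k' hy]]; apply/asboolP.
  exists (p * 'X ^+ k' - p' * 'X ^+ k), (k + k')%N.
  rewrite rmorphB !rmorphM !rmorphXn /= -hx -hy exprD mulrBl mulrA.
  by congr (_ - _); rewrite -!mulrA; congr (_ * _); rewrite mulrC.
- move=> x y /asboolP[p [k hx]] /asboolP[p' [k' hy]]; apply/asboolP.
  exists (p * p'), (k + k')%N.
  by rewrite rmorphM /= -hx -hy exprD mulrACA.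
Qed.

Record laurent := Laurent { laurent_val : ratfun; _ : laurent_pred laurent_val }.

HB.instance Definition _ := [isSub for laurent_val].
HB.instance Definition _ := [Choice of laurent by <:].
HB.instance Definition _ :=
  GRing.SubChoice_isSubComNzRing.Build ratfun laurent_pred laurent
    laurent_subring_closed.

Fact laurent_of_poly_subproof (p : {poly C}) : laurent_pred (ratfun_of_poly p).
Proof. by apply/asboolP; exists p, 0; rewrite expr0 mulr1. Qed.

Definition laurent_of_poly (p : {poly C}) : laurent :=
  Laurent (laurent_of_poly_subproof p).

Definition laurent_const (c : C) : laurent := laurent_of_poly c%:P.
Definition laurent_q : laurent := laurent_of_poly 'X.

End Laurent.

Section YokonumaHecke.
Variables (C : numFieldType) (d n : nat).

Local Notation A := (laurent C).

(* Generators are indexed from 0: t_j by j < n, and g_i by i < n-1, which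
   involves the strands lo i = i and hi i = i + 1. *)
Definition lo (i : 'I_n.-1) : 'I_n := widen_ord (leq_pred n) i.

Fact hi_subproof (i : 'I_n.-1) : (i.+1 < n)%N.
Proof. by rewrite -ltn_predRL. Qed.

Definition hi (i : 'I_n.-1) : 'I_n := Ordinal (hi_subproof i).

(* The idempotent e_i, in a ring B with given elements t_j and 1/d. Since
   t_j^d = 1, the power t_{i+1}^{-s} is t_{i+1}^(d-s). *)
Definition idem_e (B : pzRingType) (dinv : B) (t : 'I_n -> B) (i : 'I_n.-1) : B :=
  dinv * \sum_(s < d) t (lo i) ^+ s * t (hi i) ^+ (d - s).

(* The free algebra on g_0, .., g_{n-2}, t_0, .., t_{n-1}: {fmonom X} is the
   free monoid on X. *)
Definition yhFree := {malg A[{fmonom ('I_n.-1 + 'I_n)%type}]}.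

HB.instance Definition _ := GRing.NzRing.on yhFree.

Definition free_c (a : A) : yhFree := a%:MP.
Definition free_g (i : 'I_n.-1) : yhFree := << fmu (inl i) >>.
Definition free_t (j : 'I_n) : yhFree := << fmu (inr j) >>.
Definition free_e (i : 'I_n.-1) : yhFree :=
  idem_e (free_c (laurent_const d%:R^-1)) free_t i.

(* The defining relations l = r, given by the elements l - r. *)
Inductive yh_rel : yhFree -> Prop :=
| YH_gg (i j : 'I_n.-1) of (i.+1 < j)%N || (j.+1 < i)%N :
    yh_rel (free_g i * free_g j - free_g j * free_g i)
| YH_braid (i j : 'I_n.-1) of j = i.+1 :> nat :
    yh_rel (free_g i * free_g j * free_g i - free_g j * free_g i * free_g j)
| YH_tt i j :
    yh_rel (free_t i * free_t j - free_t j * free_t i)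
| YH_tg i j :
    yh_rel (free_t j * free_g i - free_g i * free_t (tperm (lo i) (hi i) j))
| YH_td j :
    yh_rel (free_t j ^+ d - 1)
| YH_quad i :
    yh_rel (free_g i ^+ 2 - (free_c (laurent_q C)
              + free_c (laurent_q C - 1) * (free_e i * free_g i))).

Definition YH := quotRing yh_rel.

HB.instance Definition _ := GRing.PzRing.on YH.

Definition yh_pi : yhFree -> YH := @quot_pi _ yh_rel.
Definition yh_c (a : A) : YH := yh_pi (free_c a).
Definition yh_g (i : 'I_n.-1) : YH := yh_pi (free_g i).
Definition yh_t (j : 'I_n) : YH := yh_pi (free_t j).
Definition yh_e (i : 'I_n.-1) : YH :=
  idem_e (yh_c (laurent_const d%:R^-1)) yh_t i.

(* The singleton {e_1 e_2 g_{1,2}} (indices 0 and 1 here); it is empty when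
   n <= 2, so that the ideal is then zero. *)
Inductive ftl_rel : YH -> Prop :=
| FTL_rel (i j : 'I_n.-1) of i = 0%N :> nat & j = 1%N :> nat :
    ftl_rel (yh_e i * yh_e j *
      (1 + yh_g i + yh_g j + yh_g i * yh_g j + yh_g j * yh_g i
         + yh_g i * yh_g j * yh_g i)).

Definition FTL := quotRing ftl_rel.

HB.instance Definition _ := GRing.PzRing.on FTL.

Definition ftl_pi : YH -> FTL := @quot_pi _ ftl_rel.
Definition ftl_c (a : A) : FTL := ftl_pi (yh_c a).

Fact ftl_c_is_zmod_morphism : zmod_morphism ftl_c.
Proof.
move=> a b; rewrite /ftl_c /ftl_pi /yh_c /yh_pi /free_c.
by rewrite [malgC _]raddfB !raddfB.
Qed.

Fact ftl_c_is_monoid_morphism : monoid_morphism ftl_c.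
Proof.
split=> [|a b]; rewrite /ftl_c /ftl_pi /yh_c /yh_pi /free_c.
  by rewrite [malgC _]rmorph1 !rmorph1.
by rewrite [malgC _]rmorphM !rmorphM.
Qed.

HB.instance Definition _ :=
  GRing.isZmodMorphism.Build A FTL ftl_c ftl_c_is_zmod_morphism.
HB.instance Definition _ :=
  GRing.isMonoidMorphism.Build A FTL ftl_c ftl_c_is_monoid_morphism.

Definition ftl_scale (a : A) (x : FTL) : FTL := ftl_c a * x.

Fact ftl_scaleA a b x : ftl_scale a (ftl_scale b x) = ftl_scale (a * b) x.
Proof. by rewrite /ftl_scale rmorphM mulrA. Qed.

Fact ftl_scale1 : left_id 1 ftl_scale.
Proof. by move=> x; rewrite /ftl_scale rmorph1 mul1r. Qed.

Fact ftl_scaleDr : right_distributive ftl_scale +%R.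
Proof. by move=> a x y; rewrite /ftl_scale mulrDr. Qed.

Fact ftl_scaleDl x : {morph ftl_scale^~ x : a b / a + b}.
Proof. by move=> a b; rewrite /ftl_scale raddfD mulrDl. Qed.

HB.instance Definition _ := GRing.Zmodule_isLmodule.Build A FTL
  ftl_scaleA ftl_scale1 ftl_scaleDr ftl_scaleDl.

(* C(q) \otimes_{C[q,q^-1]} FTL, along the inclusion C[q,q^-1] -> C(q). *)
Definition FTLq := tensor (\val : {rmorphism laurent C -> ratfun C}) FTL.

HB.instance Definition _ := GRing.Lmodule.on FTLq.

End YokonumaHecke.

Definition has_dim (F : fieldType) (V : lmodType F) (N : nat) : Prop :=
  inhabited (Vector.axiom N V).

Definition Comp (d n : nat) : {set {ffun 'I_d -> 'I_n.+1}} :=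
  [set mu : {ffun 'I_d -> 'I_n.+1} | (\sum_(i < d) mu i == n)%N].

Definition multinomial (d n : nat) (mu : {ffun 'I_d -> 'I_n.+1}) : nat :=
  (n`! %/ \prod_(i < d) (mu i)`!)%N.

Definition catalan (m : nat) : nat := ('C(2 * m, m) %/ m.+1)%N.

(* Main.v *)
(* Over C[q,q^-1] the algebra FTL splits into weight spaces for the t_j, indexed by
   colourings of the strands by Z/d, and is spanned by the products T_u E_psi of a standard
   element with a weight idempotent, u in S_n, psi : [n] -> Z/d. Between strands of
   different colours g_i is invertible (g_i^2 = q), between strands of the same colour it
   satisfies the Hecke relation, so a monochromatic 321 pattern of u can be made
   consecutive and removed with the defining relation of FTL, at the cost of terms with
   fewer monochromatic inversions. Hence the T_u E_psi without such a pattern span.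

   They are independent because FTL acts on the n-th tensor power of a space with basis
   Z/d x {0,1}, where g_i acts as the R-matrix of U_q(gl_2) on two vectors of the same
   colour. Each pair (psi, u) yields two basis words, the labels of the second kind marking
   the excedances of u within its colour class; at q = 1 the corresponding matrix of
   coefficients of the T_u E_psi is triangular with signs on the diagonal, so its
   determinant is nonzero in C(q).

   For fixed colourings of the source and of the target the admissible u are tuples of
   321-avoiding bijections between colour classes, which are counted by Catalan numbers. *)
Require Import Defs.
From HB Require Import structures.
From mathcomp Require Import all_boot all_order all_algebra fraction finmap fingroup perm.
From mathcomp Require Import ring_quotient generic_quotient.
From mathcomp Require Import boolp monalg.
From mathcomp Require Import cyclic separable cyclotomic complex reals.
From mathcomp Require Import zify ring.

Set Implicit Arguments.
Unset Strict Implicit.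
Unset Printing Implicit Defensive.

Import GRing.Theory Num.Theory.

Local Open Scope nat_scope.

(** * Words with prescribed content *)

(** Generators and relations yield spanning sets but no lower bound: a further dependency could hide
    in the ideal. The lower bound is therefore read off from one explicit module. Each element of
    the spanning set is tested on as many pairs of words as there are elements (it acts on the
    indicator of a target word, the result is read at a source word), which gives a square matrix
    with entries polynomial in [q]. One value of [q] with nonzero determinant suffices, and [q = 1]
    is convenient: there [g_i] acts as minus the flip of neighbouring positions, so an entry
    vanishes unless one permutation carries the labels of another to the same place. Avoidance of
    321 enters because such a permutation increases on its excedances and on its non-excedances, so
    that two labels per colour, as many as U_q(gl_2) offers, are enough to recover it. The weight
    spaces require 1/d and a primitive d-th root of unity among the scalars. *)

Section WordSums.
Variable T : finType.
Implicit Types (f : seq T -> nat) (l : seq T).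

Definition word_sum m f := \sum_(t : m.-tuple T) f t.

Lemma eq_word_sum m f f' : (forall l, size l = m -> f l = f' l) ->
  word_sum m f = word_sum m f'.
Proof. by move=> E; apply: eq_bigr => t _; rewrite E ?size_tuple. Qed.

Lemma word_sum0 f : word_sum 0 f = f [::].
Proof.
rewrite /word_sum (big_pred1 [tuple]) // => t.
by apply/esym/eqP; apply: tuple0.
Qed.

Lemma word_sumS m f : word_sum m.+1 f = \sum_a word_sum m (fun l => f (a :: l)).
Proof.
rewrite /word_sum pair_big /=.
rewrite (reindex (fun p : T * m.-tuple T => [tuple of p.1 :: p.2])) //=.
exists (fun t : m.+1.-tuple T => (thead t, [tuple of behead t])) => [[a t] _|t _] /=.
  by rewrite theadE; congr pair; apply: val_inj.
by rewrite [RHS]tuple_eta; apply: val_inj.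
Qed.

Lemma word_sum_ffun n f :
  word_sum n f = \sum_(w : {ffun 'I_n -> T}) f [seq w i | i <- enum 'I_n].
Proof.
rewrite /word_sum (reindex (fun w : {ffun 'I_n -> T} => [tuple w i | i < n])) /=.
  by apply: eq_bigr => w _; congr f; rewrite /= val_ord_tuple.
exists (fun t : n.-tuple T => [ffun i => tnth t i]) => [w _|t _].
  by apply/ffunP => i; rewrite ffunE tnth_mktuple.
by apply: eq_from_tnth => i; rewrite tnth_mktuple ffunE.
Qed.

Section Colours.
Variable I : finType.

Definition colour_word (chi : seq I) l c := mask [seq x == c | x <- chi] l.

(** A word of length [size chi] is an independent choice of one subword per colour. In the induction
    the first letter reaches only the colour [c0], where it is absorbed into the weight. *)
Lemma word_sum_colours (chi : seq I) (Phi : I -> seq T -> nat) :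
  word_sum (size chi) (fun l => \prod_c Phi c (colour_word chi l c))
    = \prod_c word_sum (count_mem c chi) (Phi c).
Proof.
elim: chi Phi => [|c0 chi IHchi] Phi /=.
  by rewrite word_sum0; apply: eq_bigr => c _; rewrite word_sum0.
rewrite word_sumS.
pose Psi a c l := if c0 == c then Phi c (a :: l) else Phi c l.
under eq_bigr => a _.
  rewrite (eq_word_sum (f' := fun l => \prod_c Psi a c (colour_word chi l c))).
    rewrite IHchi (bigD1 c0) //= /Psi eqxx; under eq_bigr => c cc0.
      rewrite eq_sym (negPf cc0); over.
    over.
  by move=> l _; apply: eq_bigr => c _; rewrite /Psi /colour_word /=; case: (c0 == c).
rewrite -big_distrl /= [RHS](bigD1 c0) //= eqxx add1n word_sumS; congr (_ * _).
by apply: eq_bigr => c cc0; rewrite eq_sym (negPf cc0).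
Qed.
End Colours.
End WordSums.

Section Multinomial.
Variable d : nat.

(** Removing a first letter [a] lowers [mu a] by one and takes the factor [mu a] out of the
    factorials; these factors add up to [m.+1]. *)
Lemma multinomial_count (m : nat) (mu : 'I_d -> nat) :
  word_sum m (fun l : seq 'I_d => [forall c, count_mem c l == mu c]) * \prod_c (mu c)`!
    = (\sum_c mu c == m) * m`!.
Proof.
elim: m mu => [|m IHm] mu.
  rewrite word_sum0 /=; case: forallP => [mu0|nmu].
    by rewrite !big1 // => c _; have /eqP <- := mu0 c.
  rewrite mul0n; case: eqP => // /eqP; rewrite sum_nat_eq0 => /forallP mu0; case: nmu => c.
  by rewrite eq_sym; have := mu0 c.
rewrite word_sumS big_distrl /=.
pose mu' a c := mu c - (a == c).
transitivity (\sum_a mu a * ((\sum_c mu c == m.+1) * m`!)); last first.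
  rewrite -big_distrl /=; case: eqP => [->|_]; last by rewrite !mul0n muln0.
  by rewrite mulnCA factS.
(* The truncated [mu'] is correct only for [mu a > 0]; for [mu a = 0] no admissible word begins with
   [a] and both sides are zero. *)
apply: eq_bigr => a _; have [mua|mua] := posnP (mu a).
  rewrite mua mul0n /word_sum big1 ?mul0n // => t _; case: forallP => // /(_ a).
  by rewrite /= eqxx mua.
have sum' : (\sum_c mu' a c == m) = (\sum_c mu c == m.+1).
  rewrite (bigD1 a) //= [in RHS](bigD1 a) //= /mu' eqxx.
  rewrite (eq_bigr mu); first by lia.
  by move=> c /negPf ca; rewrite eq_sym ca subn0.
rewrite -sum' -(IHm (mu' a)) mulnCA; congr (_ * _).
  apply: eq_word_sum => l _; congr (nat_of_bool _); apply: eq_forallb => c /=.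
  rewrite /mu'; have [<-|_] := eqVneq a c; last by rewrite subn0.
  by rewrite add1n; lia.
rewrite (bigD1 a) //= [in RHS](bigD1 a) //= /mu' eqxx mulnA; congr (_ * _).
  by rewrite -(prednK mua) factS subn1.
by apply: eq_bigr => c /negPf ca; rewrite eq_sym ca subn0.
Qed.
End Multinomial.

(** * 321-avoiding arrangements *)

(* The number of 321-avoiding arrangements of [m] elements in which the [j] smallest
   elements appear in increasing order. *)
Definition ballot m j := 'C(m.*2 - j, m) - 'C(m.*2 - j, m.+1).

(** The truncated subtraction is exact: with N = 2m - j one has (m+1) C(N, m+1) = (N - m) C(N, m),
    and N - m <= m. *)
Lemma ballotE m j : ballot m j + 'C(m.*2 - j, m.+1) = 'C(m.*2 - j, m).
Proof.
rewrite /ballot subnK //; have := mul_bin_left (m.*2 - j) m.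
have : m.*2 - j - m <= m by lia.
by nia.
Qed.

(** Hockey-stick summation: downward induction on [j] from the empty sum at [j = m.+1], with
    Pascal's rule for each of the two binomials. *)
Lemma ballot_tail m j : j <= m.+1 ->
  \sum_(j <= k < m.+1) ballot m k + 'C(m.*2.+1 - j, m.+2) = 'C(m.*2.+1 - j, m.+1).
Proof.
move=> le_jm; rewrite -(subKn le_jm); move: (leq_subr j m.+1).
elim: (m.+1 - j) => [_|r IHr lt_r].
  rewrite subn0 big_geq // add0n; have -> : m.*2.+1 - m.+1 = m by lia.
  by rewrite !bin_small.
have := IHr (ltnW lt_r); set k := m.+1 - r.+1.
have -> : m.+1 - r = k.+1 by lia.
have -> : m.*2.+1 - k = (m.*2 - k).+1 by lia.
rewrite subSS => IH; rewrite big_ltn; last by lia.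
rewrite binS [in RHS]binS; have := ballotE m k; lia.
Qed.

(** The recurrence obeyed by the choice of a first letter. The factor [0 < j] suppresses the last
    term at [j = 0], where the symmetry of the binomials C(2m+1, m) = C(2m+1, m+1) takes its
    place. *)
Lemma ballotS m j : j <= m.+1 ->
  ballot m.+1 j = \sum_(j <= k < m.+1) ballot m k + (0 < j) * ballot m j.-1.
Proof.
move=> le_jm; have := ballotE m.+1 j; rewrite doubleS.
case: j le_jm => [_|j le_jm] /=.
  have := ballot_tail (leq0n m.+1); rewrite !subn0 mul0n addn0.
  have : 'C(m.*2.+1, m) = 'C(m.*2.+1, m.+1).
    by rewrite -bin_sub; [congr 'C(_, _)|]; lia.
  rewrite (binS m.*2.+1 m.+1) (binS m.*2.+1 m); lia.
rewrite mul1n; have := ballot_tail (ltnW le_jm); rewrite big_ltn //.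
have -> : m.*2.+2 - j.+1 = m.*2.+1 - j by lia.
lia.
Qed.

Lemma ballot0 m : ballot m 0 = catalan m.
Proof.
have := ballotE m 0; rewrite subn0 /catalan -mul2n => E.
have := mul_bin_left (2 * m) m; have -> : 2 * m - m = m by lia.
move=> H; suff <- : m.+1 * ballot m 0 = 'C(2 * m, m) by rewrite mulKn.
by nia.
Qed.

Section Avoidance.
Variable N : nat.
Implicit Types (l Q : seq 'I_N) (a : nat).

Definition increasing_below a l := pairwise (fun x y : 'I_N => ~~ ((y < x) && (x < a))) l.

(** A 321 pattern starting at [v] is an inversion among the later letters whose larger letter is
    below [v]. *)
Fixpoint avoids321 l :=
  if l is v :: l' then increasing_below v l' && avoids321 l' else true.

Definition count_below a Q := count (fun x : 'I_N => x < a) Q.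

Lemma sum_count_below Q (G : nat -> nat) : sorted (fun x y : 'I_N => x < y) Q ->
  \sum_(v <- Q) G (count_below v Q) = \sum_(0 <= k < size Q) G k.
Proof.
elim: Q G => [|x Q IHQ] G; first by rewrite big_nil big_geq.
rewrite /= path_sortedE; last by move=> y z w; apply: ltn_trans.
case/andP => /allP xQ sQ; rewrite big_cons big_nat_recl //; congr (G _ + _).
  rewrite /count_below /= ltnn; apply/eqP; rewrite -leqn0 -(count_pred0 Q).
  by apply/eq_leq/eq_in_count => y /xQ xy; rewrite ltnNge ltnW.
rewrite -(IHQ (fun k => G k.+1)) // big_seq [RHS]big_seq; apply: eq_bigr => v vQ.
by rewrite /count_below /= (xQ v vQ).
Qed.

(* Summing over the first letter [v] of the arrangement: if [a <= v], avoidance already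
   makes everything below [a] increasing; if [v < a], then [v] has to be the minimum. *)
Lemma word_sum_avoids321_below Q a : sorted (fun x y : 'I_N => x < y) Q ->
  word_sum (size Q) (fun l => [&& perm_eq l Q, avoids321 l & increasing_below a l] : nat)
    = ballot (size Q) (count_below a Q).
Proof.
have trans : transitive (fun x y : 'I_N => x < y) by move=> y x z; apply: ltn_trans.
have irr : irreflexive (fun x y : 'I_N => x < y) by move=> x; apply: ltnn.
have [m] := ubnP (size Q); elim: m Q a => // m IHm Q a lt_Qm sQ.
have uQ := sorted_uniq trans irr sQ.
case EQ: (size Q) => [|r].
  by rewrite word_sum0 (size0nil EQ) /ballot /= !bin0 bin0n.
rewrite word_sumS; set j := count_below a Q.
(* Here [k] is the index of the first letter [v] in the sorted list [Q]: [a <= v] gives [j <= k],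
   and [v < a] gives [k < j], where only [k = 0] contributes and leaves [j.-1] elements below
   [a]. *)
pose G k := if j <= k then ballot r k else (k == 0) * ballot r j.-1.
have remS (v : 'I_N) : v \in Q -> sorted (fun x y : 'I_N => x < y) (rem v Q) /\ size (rem v Q) = r.
  move=> vQ; rewrite size_rem // EQ; split=> //.
  exact: (subseq_sorted trans (rem_subseq v Q) sQ).
have countR (v : 'I_N) b : v \in Q -> count_below b Q = (v < b) + count_below b (rem v Q).
  by move=> vQ; have /seq.permP/(_ (fun x : 'I_N => x < b)) := perm_to_rem vQ.
have inner (v : 'I_N) : v \in Q ->
  word_sum r (fun l => [&& perm_eq (v :: l) Q, avoids321 (v :: l) & increasing_below a (v :: l)])
    = G (count_below v Q).
  move=> vQ; have [sR sizeR] := remS v vQ; set k := count_below v Q.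
  have perm_v l : perm_eq (v :: l) Q = perm_eq l (rem v Q).
    by have /permPr -> := perm_to_rem vQ; rewrite perm_cons.
  have eqk : k = count_below v (rem v Q) by rewrite /k (countR v) // ltnn.
  have ltR : size (rem v Q) < m by rewrite sizeR -ltnS -EQ.
  rewrite /G; have [av|va] := leqP a v.
    have jk : j <= k by apply: sub_count => x /= xa; apply: leq_trans av.
    rewrite jk eqk -sizeR -(IHm _ v ltR sR); apply: eq_word_sum => l _.
    rewrite perm_v /=; congr (nat_of_bool (_ && _)); case: (boolP (increasing_below v l)) => iv /=; last by rewrite andbF.
    rewrite andbT; case: (avoids321 l) => //=; rewrite [X in X && _](_ : _ = true) /=.
      by apply: sub_pairwise iv => x y; apply: contra => /andP[-> xa]; rewrite (leq_trans xa).
    by apply/allP => y _; rewrite negb_and -!leqNgt av orbT.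
  have kj : k < j by rewrite eqk /j (countR v) // va ltnS; apply: sub_count => x /= xv; apply: ltn_trans va.
  rewrite leqNgt kj /=; have [k0|k0] := posnP k; last first.
    rewrite mul0n /word_sum big1 // => t _; rewrite perm_v.
    have [tR|//] := boolP (perm_eq t _); apply/eqP; rewrite eqb0 /=.
    have : has (fun x : 'I_N => x < v) (rem v Q) by rewrite has_count -/(count_below _ _) -eqk.
    case/hasP => y yR yv; rewrite !negb_and.
    have -> : ~~ all (fun y : 'I_N => ~~ ((y < v) && (v < a))) t.
      by apply/allPn; exists y; rewrite ?(perm_mem tR) // yv va.
    by rewrite !orbT.
  have above y : y \in rem v Q -> (y < v) = false.
    move=> yR; apply/negP => yv; have : 0 < count_below v (rem v Q).
      by rewrite -has_count; apply/hasP; exists y.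
    by rewrite -eqk k0.
  have -> : j.-1 = count_below a (rem v Q) by rewrite /j (countR v) // va.
  rewrite mul1n -sizeR -(IHm _ a ltR sR); apply: eq_word_sum => l _.
  rewrite perm_v; have [lR|//] := boolP (perm_eq l _); congr nat_of_bool => /=.
  have -> : all (fun y : 'I_N => ~~ ((y < v) && (v < a))) l.
    by apply/allP => y; rewrite (perm_mem lR) => /above ->.
  suff -> : increasing_below v l by [].
  have : {subset l <= rem v Q} by move=> y; rewrite (perm_mem lR).
  elim: (l) => //= x l' IHl sub; rewrite IHl ?andbT; last first.
    by move=> y yl; apply: sub; rewrite inE yl orbT.
  by apply/allP => y _; rewrite above ?andbF // sub ?mem_head.
have outer (v : 'I_N) : v \notin Q ->
  word_sum r (fun l => [&& perm_eq (v :: l) Q, avoids321 (v :: l) & increasing_below a (v :: l)]) = 0.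
  move=> vQ; rewrite /word_sum big1 // => t _; case: (boolP (perm_eq _ _)) => // /perm_mem/(_ v).
  by rewrite inE eqxx (negPf vQ).
rewrite (bigID (mem Q)) /= [X in _ + X]big1 ?addn0; last by move=> v /outer.
rewrite (eq_bigr (fun v : 'I_N => G (count_below v Q))); last by move=> v /inner.
rewrite -(big_uniq _ uQ) /= (sum_count_below G sQ) EQ.
have le_j : j <= r.+1 by rewrite -EQ count_size.
rewrite ballotS // (big_cat_nat (leq0n j) le_j) /= addnC; congr (_ + _).
  by rewrite [LHS]big_nat [RHS]big_nat; apply: eq_bigr => k /andP[jk _]; rewrite /G jk.
case: (posnP j) => [->|j0]; first by rewrite big_geq.
rewrite big_ltn // /G leqNgt j0 /= mul1n big_nat big1 ?addn0 // => k /andP[k0 kj].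
by rewrite (leqNgt j) kj /= (gtn_eqF k0).
Qed.

Lemma word_sum_avoids321 Q : sorted (fun x y : 'I_N => x < y) Q ->
  word_sum (size Q) (fun l => perm_eq l Q && avoids321 l : nat) = catalan (size Q).
Proof.
move=> sQ; rewrite -ballot0; have := word_sum_avoids321_below 0 sQ.
have -> : count_below 0 Q = 0 by apply: etrans (count_pred0 Q); apply: eq_count.
move=> <-; apply: eq_word_sum => l _; congr nat_of_bool.
have -> : increasing_below 0 l by elim: l => //= x l' ->; rewrite andbT; apply/allP => y _; rewrite andbF.
by rewrite andbT.
Qed.
End Avoidance.

(** * Inversions and standard elements *)

Section Transpositions.
Variable n : nat.
Implicit Types (i j : 'I_n.-1) (a b : 'I_n) (u : 'S_n).

Definition adj i : 'S_n := tperm (lo i) (hi i).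

Lemma adjK i : involutive (adj i).
Proof. exact: tpermK. Qed.

Lemma adjV i u : (adj i * (adj i * u))%g = u.
Proof. by rewrite mulgA tperm2 mul1g. Qed.

Lemma lo_lt_hi i : lo i < hi i.
Proof. by []. Qed.

Lemma lo_neq_hi i : lo i != hi i.
Proof. by rewrite neq_ltn lo_lt_hi. Qed.

Lemma adj_lo i : adj i (lo i) = hi i.
Proof. exact: tpermL. Qed.

Lemma adj_hi i : adj i (hi i) = lo i.
Proof. exact: tpermR. Qed.

Lemma adj_val i a :
  adj i a = (if a == i :> nat then i.+1 else if a == i.+1 :> nat then i : nat else a) :> nat.
Proof.
rewrite permE /=; case: ifP => [/eqP->|/eqP h1]; first by rewrite eqxx.
have /negPf-> : (a : nat) != i by apply/eqP => h; apply: h1; apply: val_inj.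
case: ifP => [/eqP->|/eqP h2]; first by rewrite eqxx.
by have /negPf-> : (a : nat) != i.+1 by apply/eqP => h; apply: h2; apply: val_inj.
Qed.

Lemma adj_id i a : a != i :> nat -> a != i.+1 :> nat -> adj i a = a.
Proof. by move=> h1 h2; apply: val_inj; rewrite /= adj_val (negPf h1) (negPf h2). Qed.

Lemma adj_ltn i a b : (a, b) != (lo i, hi i) -> a < b -> adj i a < adj i b.
Proof.
move=> ne lt_ab; rewrite !adj_val.
have: ~ (a = i :> nat /\ b = i.+1 :> nat).
  by case=> ha hb; case/eqP: ne; congr pair; apply: val_inj.
by do !case: eqP; lia.
Qed.

Lemma adj_far i j : (i.+1 < j) || (j.+1 < i) -> (adj i * adj j = adj j * adj i)%g.
Proof.
move=> ij; apply/permP => a; apply: val_inj; rewrite /= !permM !adj_val.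
by do !case: eqP; lia.
Qed.

Lemma adj_braid i j : j = i.+1 :> nat ->
  (adj i * (adj j * adj i) = adj j * (adj i * adj j))%g.
Proof.
move=> ij; apply/permP => a; apply: val_inj; rewrite /= !permM !adj_val.
by do !case: eqP; lia.
Qed.

(** Colours sit on positions; the constant colouring [fun=> tt] gives ordinary inversions.
    Permutations compose from left to right, so [adj i * u] is [u] with its entries at positions
    [lo i] and [hi i] exchanged. *)
Definition inversions (T : eqType) (c : 'I_n -> T) u : {set 'I_n * 'I_n} :=
  [set p : 'I_n * 'I_n | [&& p.1 < p.2, c p.1 == c p.2 & u p.2 < u p.1]].

(** Exchanging positions by [adj i] matches the inversions of the shorter permutation with those of
    [u] other than the pair of [lo i] and [hi i], which counts only if it is monochromatic. *)
Lemma card_inversions (T : eqType) (c : 'I_n -> T) u i : u (hi i) < u (lo i) ->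
  #|inversions c u|
    = #|inversions (c \o adj i) (adj i * u)%g| + (c (lo i) == c (hi i)).
Proof.
move=> desc; pose f (p : 'I_n * 'I_n) := (adj i p.1, adj i p.2).
have f_inj : injective f by move=> [a b] [a' b'] [/perm_inj-> /perm_inj->].
have -> : inversions c u = f @: inversions (c \o adj i) (adj i * u)%g
    :|: (if c (lo i) == c (hi i) then [set (lo i, hi i)] else set0).
  apply/setP => -[a b]; rewrite in_setU; apply/idP/idP.
    rewrite inE /= => /and3P[ab /eqP cab uab].
    have [[ea eb]|ne] := altP ((a, b) =P (lo i, hi i)).
      by rewrite -ea -eb cab eqxx in_set1 ea eb eqxx orbT.
    apply/orP; left; apply/imsetP; exists (f (a, b)); last by rewrite /f /= !adjK.
    by rewrite inE /= !permM !adjK cab eqxx uab adj_ltn.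
  case/orP => [/imsetP[[a' b']]|].
    rewrite inE /= !permM => /and3P[ab' cab uab] [-> ->]; rewrite inE /= cab uab !andbT.
    apply: adj_ltn => //; apply/eqP => -[ha hb].
    by move: uab; rewrite ha hb adj_lo adj_hi ltnNge ltnW.
  by case: ifP => [cc|_]; rewrite ?in_set0 // in_set1 inE => /eqP[-> ->]; rewrite /= cc desc ltnSn.
rewrite cardsU card_imset //; set I := _ :&: _.
suff -> : I = set0 by rewrite cards0 subn0; case: ifP; rewrite ?cards1 ?cards0.
apply/setP => -[a b]; rewrite in_set0 in_setI; apply/andP => -[].
case/imsetP => -[a' b']; rewrite inE /= !permM => /and3P[ab' _ _] [-> ->].
case: ifP => _; rewrite ?in_set0 // in_set1 => /eqP[ha hb].
move: ab'; rewrite -(adjK i a') -(adjK i b') ha hb adj_lo adj_hi.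
by rewrite ltnNge ltnW.
Qed.

(** Monotonicity gives [a <= u a] for every [a]; both sides have the same sum, so all the
    inequalities are equalities. *)
Lemma incr_perm1 u : (forall i, u (lo i) < u (hi i)) -> u = 1%g.
Proof.
move=> incr.
have ge a : a <= u a.
  case: a => k; elim: k => [//|k IHk] lt_k.
  have lt_k' : k < n.-1 by rewrite ltn_predRL.
  have := incr (Ordinal lt_k'); have := IHk (ltnW lt_k).
  have -> : lo (Ordinal lt_k') = Ordinal (ltnW lt_k) by apply: val_inj.
  have -> : hi (Ordinal lt_k') = Ordinal lt_k by apply: val_inj.
  by move=> /= h1 h2; apply: leq_ltn_trans h1 h2.
have E : \sum_(a < n) a = \sum_(a < n) u a.
  by rewrite (reindex_inj (@perm_inj _ u)).
have le (a : 'I_n) : true -> a <= u a ?= iff (a == u a :> nat) by split.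
have [_] := leqif_sum le; rewrite E eqxx => /esym/forallP h.
by apply/permP => a; apply: val_inj; rewrite perm1; apply/esym/eqP; apply: (h a).
Qed.

(** The argument [k] is fuel. The number of inversions suffices, since each step removes exactly
    one. *)
Fixpoint reduced_word_rec k u : seq 'I_n.-1 :=
  if k is k'.+1 then
    if [pick i | u (hi i) < u (lo i)] is Some i
    then i :: reduced_word_rec k' (adj i * u)%g else [::]
  else [::].

Definition reduced_word u := reduced_word_rec #|inversions (fun=> tt) u| u.

Lemma reduced_wordP u :
  u = 1%g /\ reduced_word u = [::] \/
  exists i, u (hi i) < u (lo i) /\ reduced_word u = i :: reduced_word (adj i * u)%g.
Proof.
rewrite /reduced_word; case E: [pick i : 'I_n.-1 | u (hi i) < u (lo i)] => [i|].
  right; exists i; have di : u (hi i) < u (lo i).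
    by move: E; case: pickP => // j dj [<-].
  by split => //; rewrite (card_inversions _ di) eqxx addn1 /= E.
left; split; last by case: #|_| => //= k; rewrite E.
apply: incr_perm1 => i; move: E; case: pickP => // /(_ i) /negbT.
rewrite -leqNgt leq_eqVlt => /orP[/eqP/val_inj/perm_inj h|//] _.
by have := lo_neq_hi i; rewrite h eqxx.
Qed.

Lemma reduced_word_ind (P : 'S_n -> Prop) : P 1%g ->
    (forall u i, u (hi i) < u (lo i) -> reduced_word u = i :: reduced_word (adj i * u)%g ->
      P (adj i * u)%g -> P u) ->
  forall u, P u.
Proof.
move=> P1 PS u; have [m] := ubnP #|inversions (fun=> tt) u|.
elim: m u => // m IHm u; rewrite ltnS => le_m.
have [[-> _] //|[i [di eq_i]]] := reduced_wordP u.
apply: (PS u i di eq_i); apply: IHm.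
by move: le_m; rewrite (card_inversions _ di) eqxx addn1.
Qed.

End Transpositions.

Section StandardElements.
Variables (n : nat) (B : pzRingType) (g : 'I_n.-1 -> B).
Local Open Scope ring_scope.
Hypothesis gg : forall i j : 'I_n.-1, (i.+1 < j)%N || (j.+1 < i)%N -> g i * g j = g j * g i.
Hypothesis braid : forall i j : 'I_n.-1, j = i.+1 :> nat -> g i * g j * g i = g j * g i * g j.

Definition stdelt (u : 'S_n) : B := \prod_(i <- reduced_word u) g i.

Lemma stdelt1 : stdelt 1%g = 1.
Proof.
rewrite /stdelt; have [[_ ->]|[i [+ _]]] := reduced_wordP (1%g : 'S_n).
  by rewrite big_nil.
by rewrite !perm1 ltnNge ltnW.
Qed.

(** Independence of the chosen descent, as in Matsumoto's theorem: the word starting with [i] and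
    the one starting with the descent [j] used by [reduced_word] are continued to a common shorter
    permutation and compared by commutation or the braid relation. *)
Lemma stdelt_desc (u : 'S_n) i : (u (hi i) < u (lo i))%N -> stdelt u = g i * stdelt (adj i * u)%g.
Proof.
have [m] := ubnP #|inversions (fun=> tt) u|.
elim: m u i => // m IHm u i; rewrite ltnS => le_m di.
have [[u1 _]|[j [dj eq_j]]] := reduced_wordP u.
  by move: di; rewrite u1 !perm1 ltnNge ltnW.
have eT : stdelt u = g j * stdelt (adj j * u)%g by rewrite /stdelt eq_j big_cons.
have smaller k : (u (hi k) < u (lo k))%N -> (#|inversions (fun=> tt) (adj k * u)%g| < m)%N.
  by move=> dk; move: le_m; rewrite (card_inversions _ dk) eqxx addn1.
(* Two adjacent descents mean that [u] decreases on three consecutive positions, so the longest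
   element of S_3 splits off in either of its reduced words. *)
have adjacent (i' j' : 'I_n.-1) : j' = i'.+1 :> nat -> (u (hi i') < u (lo i'))%N ->
    (u (hi j') < u (lo j'))%N ->
    g i' * stdelt (adj i' * u)%g = g j' * stdelt (adj j' * u)%g.
  move=> ij di' dj'.
  have hl : hi i' = lo j' by apply: val_inj.
  have ai : adj i' (hi j') = hi j' by apply: adj_id; rewrite //= ij; lia.
  have aj : adj j' (lo i') = lo i' by apply: adj_id; rewrite //= ij; lia.
  have d1 : ((adj i' * u)%g (hi j') < (adj i' * u)%g (lo j'))%N.
    by rewrite !permM ai -hl adj_hi (ltn_trans dj') // -hl.
  have d2 : ((adj j' * u)%g (hi i') < (adj j' * u)%g (lo i'))%N.
    by rewrite !permM aj hl adj_lo (ltn_trans dj') // -hl.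
  have s1 := smaller _ di'; have s2 := smaller _ dj'.
  rewrite (IHm _ _ s1 d1) (IHm _ _ s2 d2).
  have {}s1 : (#|inversions (fun=> tt) (adj j' * (adj i' * u))%g| < m)%N.
    by apply: leq_trans (ltnW s1); rewrite (card_inversions _ d1) eqxx addn1 ltnS leqnn.
  have {}s2 : (#|inversions (fun=> tt) (adj i' * (adj j' * u))%g| < m)%N.
    by apply: leq_trans (ltnW s2); rewrite (card_inversions _ d2) eqxx addn1 ltnS leqnn.
  rewrite (IHm _ i' s1); last first.
    by rewrite !permM aj adj_lo hl adj_lo ai.
  rewrite (IHm _ j' s2); last first.
    by rewrite !permM ai adj_hi -hl adj_hi aj.
  rewrite !mulrA braid //; congr (_ * stdelt _).
  by rewrite !mulgA -(mulgA (adj i')) adj_braid // mulgA.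
have distant (ij : (i.+1 < j)%N || (j.+1 < i)%N) :
    g i * stdelt (adj i * u)%g = g j * stdelt (adj j * u)%g.
  have fix_far (k l : 'I_n.-1) : (k.+1 < l)%N || (l.+1 < k)%N ->
      adj k (lo l) = lo l /\ adj k (hi l) = hi l.
    by move=> kl; split; apply: adj_id; apply/eqP => /=; lia.
  have [lij hij] := fix_far _ _ ij.
  have [lji hji] : adj j (lo i) = lo i /\ adj j (hi i) = hi i.
    by apply: fix_far; rewrite orbC ij.
  rewrite (IHm (adj i * u)%g j (smaller _ di)) ?permM ?lij ?hij //.
  rewrite (IHm (adj j * u)%g i (smaller _ dj)) ?permM ?lji ?hji //.
  by rewrite !mulrA gg // !mulgA adj_far // orbC.
have [ij|ij|/val_inj ij] := ltngtP i j; last by rewrite ij.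
- have [ij'|ij'] := eqVneq (j : nat) i.+1; first by rewrite eT (adjacent i j).
  by rewrite eT distant //; lia.
- have [ij'|ij'] := eqVneq (i : nat) j.+1; first by rewrite eT (adjacent j i).
  by rewrite eT distant //; lia.
Qed.

End StandardElements.

(** The colours belong to the values of [u], since [psi] is the weight on the right of T_u E_psi;
    position [i] therefore carries [psi (u i)]. *)
Definition good d n (psi : {ffun 'I_n -> 'I_d}) (u : 'S_n) :=
  [forall i : 'I_n, forall j : 'I_n, forall k : 'I_n,
    [&& i < j, j < k, psi (u i) == psi (u j) & psi (u j) == psi (u k)]
      ==> ~~ ((u k < u j) && (u j < u i))].

(** * Excedance labels *)

Section Ranks.
Variables (n : nat) (T : eqType).
Implicit Types (c : 'I_n -> T) (u : 'S_n).

Definition rank c (a : 'I_n) := #|[set b : 'I_n | (b < a) && (c b == c a)]|.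

Lemma rank_lt c (a b : 'I_n) : a < b -> c a = c b -> rank c a < rank c b.
Proof.
move=> ab cab; apply: proper_card; apply/properP; split.
  by apply/subsetP => k; rewrite !inE => /andP[ka /eqP->]; rewrite (ltn_trans ka ab) cab eqxx.
by exists a; rewrite inE ?ltnn // ab cab eqxx.
Qed.

Lemma rank_inj c (a b : 'I_n) : c a = c b -> rank c a = rank c b -> a = b.
Proof.
move=> cab rab; apply: val_inj; case: (ltngtP a b) => // [ab|ba].
  by have := rank_lt ab cab; rewrite rab ltnn.
by have := rank_lt ba (esym cab); rewrite rab ltnn.
Qed.

Lemma rank_increasing c u : (forall a b : 'I_n, a < b -> c a = c b -> u a < u b) ->
  forall a, rank (c \o u^-1%g) (u a) = rank c a.
Proof.
move=> inc a; rewrite /rank -[RHS](card_imset _ (@perm_inj _ u)).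
apply: eq_card => k; rewrite !inE /= permK; apply/idP/imsetP => [/andP[ka /eqP ck]|[b]].
  exists (u^-1%g k); rewrite ?permKV // inE ck eqxx andbT.
  rewrite ltnNge leq_eqVlt; apply/negP => /orP[/eqP/val_inj h|h].
    by move: ka; rewrite -[k](permKV u) -h ltnn.
  by have := inc _ _ h (esym ck); rewrite permKV ltnNge ltnW.
by rewrite inE => /andP[ba /eqP cb] ->; rewrite permK cb eqxx inc.
Qed.

(** A permutation increasing on each class preserves ranks within the class, so its value at [a] is
    pinned down by the transported colouring and the rank of [a]. *)
Lemma increasing_perm_uniq c (u v : 'S_n) :
    (forall a b : 'I_n, a < b -> c a = c b -> u a < u b) ->
    (forall a b : 'I_n, a < b -> c a = c b -> v a < v b) ->
    c \o u^-1%g =1 c \o v^-1%g -> u = v.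
Proof.
move=> inc_u inc_v cuv; apply/permP => a; have /= := cuv (u a); rewrite permK => ca.
rewrite -[LHS](permKV v); congr (v _); apply: (@rank_inj c); rewrite -?ca //.
rewrite -(rank_increasing inc_v) permKV -(rank_increasing inc_u a) /rank.
by apply: eq_card => k; rewrite !inE; have /= -> := cuv k; have /= -> := cuv (u a).
Qed.
End Ranks.

Section Codes.
Variables d n : nat.
Implicit Types (psi : {ffun 'I_n -> 'I_d}) (u : 'S_n).

(** Ranks turn the restriction of [u] to one colour into an ordinary permutation, and these are its
    strict excedances. *)
Definition excedance psi u (a : 'I_n) := rank (psi \o u) a < rank psi (u a).

Definition source_label psi u : {ffun 'I_n -> 'I_d * bool} :=
  [ffun a => (psi (u a), excedance psi u a)].

(** Truncation leaves only the excedances. One term is even and the other odd, so they never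
    coincide; this lets the equality case of [triangularity] recover the excedance set. *)
Definition weight_excess psi u :=
  \sum_a ((rank psi (u a)).*2 - (rank (psi \o u) a).*2.+1).

Lemma rank_comp psi u a :
  rank psi (u a) = #|[set b : 'I_n | (u b < u a) && (psi (u b) == psi (u a))]|.
Proof.
rewrite /rank -[RHS](card_imset _ (@perm_inj _ u)); apply: eq_card => k.
rewrite !inE; apply/idP/imsetP => [h|[b + ->]]; last by rewrite inE.
by exists (u^-1%g k); rewrite ?permKV // inE permKV.
Qed.

(** Suppose [u b < u a]. If [b] is an excedance, some smaller value of its colour sits after [b] and
    completes a 321 pattern. If not, avoidance puts all entries of that colour before [a] below
    [u a], and [u b] is one more, so [a] is an excedance, against the equality of labels. *)
Lemma good_increasing psi u (a b : 'I_n) : good psi u ->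
  a < b -> source_label psi u a = source_label psi u b -> u a < u b.
Proof.
move=> gu ab; rewrite !ffunE => -[cab eab].
rewrite ltnNge leq_eqVlt; apply/negP => /orP[/eqP/val_inj/perm_inj h|uba].
  by move: ab; rewrite h ltnn.
have nopat (i j k : 'I_n) : i < j -> j < k -> psi (u i) = psi (u j) -> psi (u j) = psi (u k) ->
    u j < u i -> u k < u j -> False.
  move=> ij jk cij cjk uji ukj.
  move/forallP: gu => /(_ i)/forallP/(_ j)/forallP/(_ k).
  by rewrite ij jk cij cjk eqxx uji ukj.
have [eb|/negbTE neb] := boolP (excedance psi u b).
  move: (eb); rewrite /excedance rank_comp /rank ltnNge => /negP; apply.
  apply: subset_leq_card; apply/subsetP => k; rewrite !inE /= => /andP[ukb /eqP ck].
  rewrite ck eqxx andbT ltnNge leq_eqVlt; apply/negP => /orP[/eqP/val_inj h|bk].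
    by move: ukb; rewrite h ltnn.
  by apply: (nopat a b k).
move: eab; rewrite neb => /negbT/negP; apply; rewrite /excedance rank_comp.
apply: proper_card; apply/properP; split; last first.
  by exists b; rewrite !inE /= ?uba ?cab ?eqxx // andbT -leqNgt ltnW.
apply/subsetP => k; rewrite !inE /= => /andP[ka /eqP ck].
rewrite ck eqxx andbT ltnNge leq_eqVlt; apply/negP => /orP[/eqP/val_inj/perm_inj h|uak].
  by move: ka; rewrite h ltnn.
by apply: (nopat k a b).
Qed.

(* The sum over the excedances [a] of [u] of [2 * rank psi (u a) - 2 * rank a - 1] is
   determined by the labels alone; replacing [u] by [v] it is at most the weight excess
   of [v], with equality only if [v] has the same excedances as [u]. *)
Lemma triangularity psi (u v : 'S_n) : good psi u -> good psi v ->
    source_label psi u \o u^-1%g =1 source_label psi u \o v^-1%g ->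
  u = v \/ weight_excess psi u < weight_excess psi v.
Proof.
move=> gu gv E.
have Ev a : source_label psi u (u^-1%g (v a)) = source_label psi u a.
  by have /= := E (v a); rewrite permK.
have col a : psi (v a) = psi (u a).
  by have /(congr1 fst) := Ev a; rewrite !ffunE /= permKV.
have rk a : rank (psi \o v) a = rank (psi \o u) a.
  by apply: eq_card => k; rewrite !inE /= !col.
pose x a := (rank (psi \o u) a).*2.+1.
pose U a := (rank psi (u a)).*2; pose V a := (rank psi (v a)).*2.
have excU a : excedance psi u a = (x a <= U a).
  by rewrite /excedance /x /U; lia.
have excV a : excedance psi v a = (x a <= V a).
  by rewrite /excedance rk /x /V; lia.
(* By [E] both permutations send the excedances of [u] onto the same set of values, so reindexing by
   [v * u^-1] turns one sum into the other. *)
have SUV : \sum_(a | excedance psi u a) U a = \sum_(a | excedance psi u a) V a.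
  rewrite (reindex_inj (@perm_inj _ (v * u^-1)%g)) /=.
  apply: eq_big => [a|a _]; last by rewrite /U /V permM permKV.
  by have /(congr1 snd) := Ev a; rewrite !ffunE permM.
have [le_vu|] := leqP (weight_excess psi v) (weight_excess psi u); last by right.
left.
have defU : weight_excess psi u + \sum_(a | excedance psi u a) x a
    = \sum_(a | excedance psi u a) U a.
  rewrite /weight_excess (bigID (excedance psi u)) /= [X in _ + X + _]big1 ?addn0.
    by rewrite -big_split; apply: eq_bigr => a; rewrite excU => h; apply: subnK.
  by move=> a; rewrite excU -ltnNge -/(U a) -/(x a); lia.
have defV : weight_excess psi v = \sum_a (V a - x a).
  by apply: eq_bigr => a _; rewrite rk.
(* In natural numbers [V a - x a + x a - V a] is the truncated [x a - V a]: it is positive where [v]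
   loses an excedance of [u], while the second sum detects those that [v] gains. *)
have EV : \sum_(a | excedance psi u a) (V a - x a + x a - V a)
    + \sum_(a | ~~ excedance psi u a) (V a - x a) = 0.
  have : \sum_(a | excedance psi u a) (V a - x a + x a - V a)
    + \sum_(a | excedance psi u a) V a = \sum_(a | excedance psi u a) (V a - x a) + \sum_(a | excedance psi u a) x a.
    by rewrite -!big_split /=; apply: eq_bigr => a _; lia.
  have : weight_excess psi v = \sum_(a | excedance psi u a) (V a - x a)
    + \sum_(a | ~~ excedance psi u a) (V a - x a) by rewrite defV (bigID (excedance psi u)).
  by rewrite -SUV -defU; lia.
have [/eqP E1 /eqP E2] : (\sum_(a | excedance psi u a) (V a - x a + x a - V a) == 0)
    /\ (\sum_(a | ~~ excedance psi u a) (V a - x a) == 0) by lia.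
have exc a : excedance psi v a = excedance psi u a.
  rewrite excV; have [ea|ea] := boolP (excedance psi u a).
    by move/eqP: E1; rewrite sum_nat_eq0 => /forallP/(_ a)/implyP/(_ ea); lia.
  by move/eqP: E2; rewrite sum_nat_eq0 => /forallP/(_ a)/implyP/(_ ea); rewrite /V /x; lia.
have lab : source_label psi v = source_label psi u.
  by apply/ffunP => a; rewrite !ffunE col exc.
apply: (increasing_perm_uniq _ _ E) => a b ab cab; first exact: good_increasing gu ab cab.
by apply: good_increasing gv ab _; rewrite lab.
Qed.
End Codes.

(** * Counting the basis *)

Section GoodCount.
Variables d n : nat.
Implicit Types (psi lam : {ffun 'I_n -> 'I_d}) (s : seq 'I_n).

Lemma sorted_enum_filter (p : pred 'I_n) :
  sorted (fun x y : 'I_n => x < y) [seq i <- enum 'I_n | p i].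
Proof.
apply: sorted_filter; first by move=> y x z; apply: ltn_trans.
by have := iota_ltn_sorted 0 n; rewrite -val_enum_ord sorted_map.
Qed.

Lemma increasing_belowP (w : 'I_n -> 'I_n) a s : sorted (fun x y : 'I_n => x < y) s ->
  reflect (forall j k, j \in s -> k \in s -> j < k -> ~~ ((w k < w j) && (w j < a)))
    (increasing_below a [seq w i | i <- s]).
Proof.
have trans : transitive (fun x y : 'I_n => x < y) by move=> y x z; apply: ltn_trans.
rewrite /increasing_below pairwise_map sorted_pairwise //.
elim: s => [_|x s IHs] /=; first by constructor.
case/andP => /allP xs /IHs {}IHs; apply: (iffP andP) => [[/allP hx /IHs hs] j k|h].
  rewrite !inE => /orP[/eqP->|js] /orP[/eqP->|ks]; rewrite ?ltnn //.
  - by move=> _; apply: hx.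
  - by rewrite ltnNge ltnW // xs.
  - exact: hs.
split; first by apply/allP => k ks; apply: h; rewrite ?mem_head ?inE ?ks ?orbT // xs.
by apply/IHs => j k js ks; apply: h; rewrite inE ?js ?ks orbT.
Qed.

Lemma avoids321P (w : 'I_n -> 'I_n) s : sorted (fun x y : 'I_n => x < y) s ->
  reflect (forall i j k, i \in s -> j \in s -> k \in s -> i < j -> j < k ->
      ~~ ((w k < w j) && (w j < w i)))
    (avoids321 [seq w i | i <- s]).
Proof.
have trans : transitive (fun x y : 'I_n => x < y) by move=> y x z; apply: ltn_trans.
elim: s => [_|x s IHs] /=; first by constructor.
rewrite path_sortedE // => /andP[/allP xs ss].
apply: (iffP andP) => [[/(increasing_belowP w (w x) ss) hx /(IHs ss) hs] i j k|h].
  rewrite !inE => /orP[/eqP->|is_] /orP[/eqP->|js] /orP[/eqP->|ks]; rewrite ?ltnn //.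
  - by move=> _; rewrite ltnNge ltnW // xs.
  - by move=> _; apply: hx.
  - by rewrite ltnNge ltnW // xs.
  - by move=> _; rewrite ltnNge ltnW // xs.
  - exact: hs.
split.
  apply/(increasing_belowP w (w x) ss) => j k js ks jk.
  by apply: (h x j k); rewrite ?inE ?eqxx ?js ?ks ?orbT // xs.
by apply/(IHs ss) => i j k is_ js ks; apply: h; rewrite inE ?is_ ?js ?ks orbT.
Qed.

Definition class psi c := [seq i <- enum 'I_n | psi i == c].

Lemma mem_class psi c i : (i \in class psi c) = (psi i == c).
Proof. by rewrite mem_filter mem_enum andbT. Qed.

Lemma class_uniq psi c : uniq (class psi c).
Proof. by rewrite filter_uniq ?enum_uniq. Qed.

Definition arrangement psi c (l : seq 'I_n) := perm_eq l (class psi c) && avoids321 l.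

Lemma uniq_map_inj_in (T T' : eqType) (f : T -> T') (s : seq T) :
  uniq [seq f x | x <- s] -> {in s &, injective f}.
Proof.
elim: s => //= x s IHs /andP[fx us] a b; rewrite !inE.
case/predU1P => [->|as_] /predU1P[->|bs] // E; last exact: (IHs us).
  by move: fx; rewrite E map_f.
by move: fx; rewrite -E map_f.
Qed.

(** Once the colours [lam] of the positions are prescribed, [u] is one arrangement of [class psi c]
    on the positions [class lam c] for each colour, and avoidance is a condition on each colour
    alone. *)
Lemma card_good psi lam :
  #|[set u : 'S_n | good psi u & [forall i, psi (u i) == lam i]]|
    = \prod_c word_sum (size (class lam c)) (arrangement psi c).
Proof.
have E c : size (class lam c) = count_mem c [seq lam i | i <- enum 'I_n].
  by rewrite size_filter [RHS]count_map; apply: eq_count.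
under [RHS]eq_bigr => c _ do rewrite E.
rewrite -word_sum_colours size_map size_enum_ord word_sum_ffun.
pose ok (w : {ffun 'I_n -> 'I_n}) := [forall c, arrangement psi c [seq w i | i <- class lam c]].
transitivity (\sum_(w | ok w) 1); last first.
  rewrite big_mkcond /=; apply: eq_bigr => w _.
  have Ec c : colour_word [seq lam i | i <- enum 'I_n] [seq w i | i <- enum 'I_n] c
      = [seq w i | i <- class lam c].
    by rewrite /colour_word -map_comp -map_mask -filter_mask.
  under eq_bigr => c _ do rewrite Ec.
  rewrite /ok; case: forallP => [h|h].
    by rewrite big1 // => c _; rewrite h.
  apply/esym/eqP; rewrite -leqn0 leqNgt; apply/negP => pos; apply: h => c.
  by move: pos; rewrite (bigD1 c) //= muln_gt0 lt0b => /andP[].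
rewrite sum1_card -(card_imset _ (f := fun u : 'S_n => [ffun i => u i])); last first.
  by move=> u v /ffunP E'; apply/permP => i; have := E' i; rewrite !ffunE.
apply: eq_card => w; apply/imsetP/idP => [[u + ->{w}]|/forallP okw].
  rewrite inE => /andP[gu /forallP col]; apply/forallP => c.
  have -> : [seq [ffun i => u i] i | i <- class lam c] = [seq u i | i <- class lam c].
    by apply: eq_map => i; rewrite ffunE.
  apply/andP; split.
    apply: uniq_perm; rewrite ?class_uniq ?map_inj_uniq ?class_uniq //; first exact: perm_inj.
    move=> k; rewrite -[k](permKV u) (mem_map (@perm_inj _ u)) !mem_class.
    by rewrite (eqP (col _)).
  apply/avoids321P; first exact: sorted_enum_filter.
  move=> i j k; rewrite !mem_class => /eqP ci /eqP cj /eqP ck ij jk.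
  move/forallP: gu => /(_ i)/forallP/(_ j)/forallP/(_ k)/implyP; apply.
  by rewrite ij jk !(eqP (col _)) ci cj ck eqxx.
have col i : psi (w i) = lam i.
  have /andP[/perm_mem/(_ (w i)) + _] := okw (lam i).
  by rewrite map_f ?mem_class // => /esym/eqP.
have w_inj : injective w.
  move=> i j wij; have /andP[/perm_uniq + _] := okw (lam i); rewrite class_uniq.
  move/uniq_map_inj_in; apply=> //; rewrite mem_class //.
  by rewrite -!col wij.
exists (perm w_inj); last by apply/ffunP => i; rewrite ffunE permE.
rewrite inE; apply/andP; split; last by apply/forallP => i; rewrite permE col.
apply/forallP => i; apply/forallP => j; apply/forallP => k; rewrite !permE.
apply/implyP => /and4P[ij jk /eqP cij /eqP cjk]; rewrite !col in cij cjk.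
have /andP[_ /(avoids321P w (sorted_enum_filter _)) h] := okw (lam i).
by apply: (h i j k); rewrite ?mem_class ?cij ?cjk.
Qed.

Definition content psi : {ffun 'I_d -> 'I_n.+1} := [ffun c => inord (size (class psi c))].

Lemma contentE psi c : content psi c = size (class psi c) :> nat.
Proof.
rewrite ffunE inordK // ltnS -[X in _ <= X](size_enum_ord n) size_filter.
exact: count_size.
Qed.

Lemma content_Comp psi : content psi \in Comp d n.
Proof.
rewrite inE; under eq_bigr => c _ do rewrite contentE size_filter -sum1_count.
rewrite -[X in _ == X](size_enum_ord n) -sum1_size.
by rewrite (partition_big psi predT) //=.
Qed.

Lemma prod_arrangements psi lam :
  \prod_c word_sum (size (class lam c)) (arrangement psi c)
    = (content lam == content psi) * \prod_c catalan (content psi c).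
Proof.
have [E|ne] := eqVneq (content lam) (content psi).
  rewrite mul1n; apply: eq_bigr => c _.
  rewrite -contentE E contentE; apply: word_sum_avoids321; exact: sorted_enum_filter.
have [c nec] : exists c, size (class lam c) != size (class psi c).
  apply/existsP; rewrite -negb_forall; apply: contra ne => /forallP h.
  by apply/eqP/ffunP => c; rewrite !ffunE (eqP (h c)).
rewrite (bigD1 c) //= mul0n /word_sum big1 // => t _.
rewrite /arrangement; case: (boolP (perm_eq _ _)) => // /perm_size.
by rewrite size_tuple => e; rewrite e eqxx in nec.
Qed.

Lemma card_content (mu : {ffun 'I_d -> 'I_n.+1}) : mu \in Comp d n ->
  #|[set psi : {ffun 'I_n -> 'I_d} | content psi == mu]| = multinomial mu.
Proof.
rewrite inE => /eqP sum_mu; have := multinomial_count n (fun c => mu c).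
rewrite sum_mu eqxx mul1n => E.
rewrite /multinomial -E mulnK; last by rewrite prodn_gt0 // => c; rewrite fact_gt0.
rewrite word_sum_ffun -sum1dep_card big_mkcond; apply: eq_bigr => psi _.
suff -> : (content psi == mu) = [forall c, count_mem c [seq psi i | i <- enum 'I_n] == mu c].
  by case: forallP.
have C c : count_mem c [seq psi i | i <- enum 'I_n] = content psi c.
  by rewrite contentE size_filter count_map.
apply/eqP/forallP => [<- c|h]; first by rewrite C.
by apply/ffunP => c; apply: val_inj; rewrite /= -C; apply/eqP.
Qed.

(** The square counts two colourings of equal content: [psi] on the values and [lam = psi \o u] on
    the positions. *)
Lemma card_good_pairs :
  #|[set p : {ffun 'I_n -> 'I_d} * 'S_n | good p.1 p.2]|
    = \sum_(mu in Comp d n) multinomial mu ^ 2 * \prod_(i < d) catalan (mu i).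
Proof.
pose P (mu : {ffun 'I_d -> 'I_n.+1}) := \prod_(i < d) catalan (mu i).
transitivity (\sum_psi \sum_lam (content lam == content psi) * P (content psi)).
  rewrite -sum1dep_card big_mkcond /= -(pair_bigA _ (fun psi u => if good psi u then 1 else 0)) /=.
  apply: eq_bigr => psi _.
  rewrite (partition_big (fun u : 'S_n => [ffun i => psi (u i)]) predT) //=.
  apply: eq_bigr => lam _; rewrite -prod_arrangements -card_good.
  rewrite -sum1dep_card [RHS]big_mkcond [LHS]big_mkcond; apply: eq_bigr => u _ /=.
  have -> : [forall i, psi (u i) == lam i] = ([ffun i => psi (u i)] == lam).
    apply/forallP/eqP => [h|<- i]; last by rewrite ffunE.
    by apply/ffunP => i; rewrite ffunE (eqP (h i)).
  by case: (_ == lam); case: (good psi u).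
rewrite (partition_big content (mem (Comp d n))) /=; last by move=> psi _; apply: content_Comp.
apply: eq_bigr => mu mu_comp.
transitivity (\sum_(psi | content psi == mu) multinomial mu * P mu).
  apply: eq_bigr => psi /eqP ->; rewrite -big_distrl /=; congr (_ * _).
  by rewrite -(card_content mu_comp) -sum1dep_card [RHS]big_mkcond.
by rewrite sum_nat_cond_const -(card_content mu_comp) cardsE mulnA mulnn.
Qed.
End GoodCount.

(** * The spanning set *)

Local Open Scope ring_scope.

Section Span.
Variables (A : comNzRingType) (B : pzRingType) (c : {rmorphism A -> B}).
Hypothesis central : forall a x, c a * x = x * c a.
Implicit Types S : B -> Prop.

(** The ring [B] carries its scalars only through the central morphism [c], so linear combinations
    are built by hand. *)
Inductive lspan S : B -> Prop :=
| Span0 : lspan S 0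
| SpanD a x y of S x & lspan S y : lspan S (c a * x + y).

Lemma span_gen S x : S x -> lspan S x.
Proof. by move=> Sx; rewrite -[x]addr0 -[x]mul1r -(rmorph1 c); apply: SpanD Sx _; apply: Span0. Qed.

Lemma spanD S x y : lspan S x -> lspan S y -> lspan S (x + y).
Proof.
move=> + Sy; elim=> [|a x' x1 Sx' _ IH]; first by rewrite add0r.
by rewrite -addrA; apply: SpanD.
Qed.

Lemma spanZ S a x : lspan S x -> lspan S (c a * x).
Proof.
elim=> [|a' x' x1 Sx' _ IH]; first by rewrite mulr0; apply: Span0.
by rewrite mulrDr mulrA -rmorphM; apply: SpanD.
Qed.

Lemma spanN S x : lspan S x -> lspan S (- x).
Proof. by rewrite -mulN1r -(rmorphN1 c); apply: spanZ. Qed.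

Lemma span_sum S (I : Type) (r : seq I) (P : pred I) (F : I -> B) :
  (forall i, P i -> lspan S (F i)) -> lspan S (\sum_(i <- r | P i) F i).
Proof. by move=> SF; elim/big_ind: _ => //; [apply: Span0 | apply: spanD]. Qed.

Lemma span_mull S S' z : (forall x, S x -> lspan S' (z * x)) ->
  forall x, lspan S x -> lspan S' (z * x).
Proof.
move=> SS' x; elim=> [|a x' x1 Sx' _ IH]; first by rewrite mulr0; apply: Span0.
by rewrite mulrDr mulrA -central -mulrA; apply: spanD (spanZ _ (SS' _ Sx')) IH.
Qed.

Lemma span_trans S S' : (forall x, S x -> lspan S' x) -> forall x, lspan S x -> lspan S' x.
Proof. by move=> SS' x Sx; rewrite -[x]mul1r; apply: span_mull Sx => y /SS'; rewrite mul1r. Qed.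

Lemma span_family (I : finType) (b : I -> B) x :
  lspan (fun y => exists i, y = b i) x -> exists f : I -> A, x = \sum_i c (f i) * b i.
Proof.
elim=> [|a _ y [i ->] _ [f ->]].
  by exists (fun=> 0); rewrite big1 // => i _; rewrite rmorph0 mul0r.
exists (fun j => (if j == i then a else 0) + f j).
under [RHS]eq_bigr => j _ do rewrite rmorphD mulrDl.
rewrite big_split /= [X in _ = X + _](bigD1 i) //= eqxx [X in _ + X + _]big1 ?addr0 // => j /negPf->.
by rewrite rmorph0 mul0r.
Qed.
End Span.

Section RootOfUnity.
Variables (A : comNzRingType) (d : nat) (z dinv : A).
Hypotheses (dinvd : dinv * d%:R = 1) (zd : z ^+ d = 1).
Hypothesis orth : forall k, \sum_(s < d) z ^+ (s * k) = if (d %| k)%N then d%:R else 0.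

Lemma z_mod k l : k = l %[mod d] -> z ^+ k = z ^+ l.
Proof.
by move=> kl; rewrite (divn_eq k d) (divn_eq l d) kl !exprD !(mulnC _ d) !exprM zd !expr1n.
Qed.

(** Because [z ^+ d = 1], the exponent [d - s] stands for [- s]; and [a + (d - b)] lies strictly
    between 0 and 2d, so it is divisible by [d] only when [a = b]. *)
Lemma root_orthogonality (a b : 'I_d) :
  dinv * (\sum_(s < d) z ^+ (s * a + (d - s) * b)) = (a == b)%:R.
Proof.
have -> : \sum_(s < d) z ^+ (s * a + (d - s) * b) = \sum_(s < d) z ^+ (s * (a + (d - b))).
  apply: eq_bigr => s _; apply: z_mod.
  apply/eqP; rewrite mulnDr eqn_modDl mulnBl mulnBr -(eqn_modDr (s * b)) subnK ?subnK.
  - by rewrite modnMr modnMl.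
  - by rewrite leq_mul // ltnW.
  - by rewrite leq_mul // ltnW.
have -> : (a == b) = (d %| a + (d - b))%N.
  have lta : (a < d)%N by exact: ltn_ord.
  have ltb : (b < d)%N by exact: ltn_ord.
  rewrite -val_eqE /= addnBA; last exact: ltnW.
  apply/eqP/idP => [->|]; first by rewrite addKn.
  by move/dvdnP => [k]; case: k => [|[|k]]; lia.
by rewrite orth; case: ifP => _; rewrite ?dinvd ?mulr0.
Qed.
End RootOfUnity.

Section FramedAlgebra.
Variables (A : comNzRingType) (B : pzRingType) (c : {rmorphism A -> B}).
Hypothesis central : forall a x, c a * x = x * c a.
Variables (d n : nat) (q qi z dinv : A).
Hypotheses (qiq : qi * q = 1) (dinvd : dinv * d%:R = 1) (zd : z ^+ d = 1).
Hypothesis orth : forall k, \sum_(s < d) z ^+ (s * k) = if (d %| k)%N then d%:R else 0.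
Variables (g e : 'I_n.-1 -> B) (t : 'I_n -> B).
Hypothesis eE : forall i, e i = idem_e d (c dinv) t i.
Hypothesis gg : forall i j : 'I_n.-1, (i.+1 < j)%N || (j.+1 < i)%N -> g i * g j = g j * g i.
Hypothesis braid : forall i j : 'I_n.-1, j = i.+1 :> nat -> g i * g j * g i = g j * g i * g j.
Hypothesis tt : forall i j, t i * t j = t j * t i.
Hypothesis tg : forall i j, t j * g i = g i * t (adj i j).
Hypothesis td : forall j, t j ^+ d = 1.
Hypothesis quad : forall i, g i ^+ 2 = c q + c (q - 1) * (e i * g i).

Definition symmetrizer (i j : 'I_n.-1) : B :=
  1 + g i + g j + g i * g j + g j * g i + g i * g j * g i.

Hypothesis kill : forall i j : 'I_n.-1, i = 0%N :> nat -> j = 1%N :> nat ->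
  e i * e j * symmetrizer i j = 0.

Definition weight (lam : 'I_n -> 'I_d) (y : B) := forall j, t j * y = c (z ^+ lam j) * y.

Lemma eq_weight lam lam' y : lam =1 lam' -> weight lam y -> weight lam' y.
Proof. by move=> E W j; rewrite W E. Qed.

Lemma weightD lam x y : weight lam x -> weight lam y -> weight lam (x + y).
Proof. by move=> Wx Wy j; rewrite !mulrDr Wx Wy. Qed.

Lemma weight_g lam i y : weight lam y -> weight (lam \o adj i) (g i * y).
Proof. by move=> W j; rewrite mulrA tg -mulrA W mulrA -central -mulrA. Qed.

Lemma weight_exp lam y j s : weight lam y -> t j ^+ s * y = c (z ^+ (s * lam j)) * y.
Proof.
move=> W; elim: s => [|s IHs]; first by rewrite mul0n !expr0 rmorph1.
by rewrite exprS -mulrA IHs mulrA -central -mulrA W mulrA -rmorphM -exprD mulSn addnC.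
Qed.

Lemma weight_e lam i y : weight lam y ->
  e i * y = if lam (lo i) == lam (hi i) then y else 0.
Proof.
move=> W; have -> : e i * y
    = c (dinv * \sum_(s < d) z ^+ (s * lam (lo i) + (d - s) * lam (hi i))) * y.
  rewrite eE /idem_e -mulrA mulr_suml rmorphM -mulrA; congr (_ * _).
  rewrite rmorph_sum mulr_suml; apply: eq_bigr => s _.
  rewrite -mulrA (weight_exp _ _ W) mulrA -central -mulrA (weight_exp _ _ W) mulrA.
  by rewrite -rmorphM -exprD addnC.
rewrite (root_orthogonality dinvd zd orth).
by case: eqP => _; rewrite ?rmorph1 ?rmorph0 ?mul1r ?mul0r.
Qed.

(** Discrete Fourier projection onto the eigenvalue [z ^+ a] of [t j], with [d - s] in the role of
    [- s]. *)
Definition proj1 j (a : 'I_d) : B :=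
  c dinv * \sum_(s < d) c (z ^+ ((d - s) * a)) * t j ^+ s.

Definition proj (psi : {ffun 'I_n -> 'I_d}) : B := \prod_(j < n) proj1 j (psi j).

Lemma sum_proj1 j : \sum_a proj1 j a = 1.
Proof.
rewrite -mulr_sumr exchange_big /=.
have E (s : 'I_d) : \sum_(a < d) c (z ^+ ((d - s) * a)) * t j ^+ s
    = if s == 0%N :> nat then c d%:R else 0.
  rewrite -mulr_suml -rmorph_sum; under eq_bigr => a _ do rewrite mulnC.
  rewrite orth; case: (posnP s) => [->|s0]; first by rewrite subn0 dvdnn mulr1.
  by rewrite gtnNdvd ?rmorph0 ?mul0r ?subn_gt0 // ltn_subrL s0 (leq_ltn_trans _ (ltn_ord s)).
under eq_bigr => s _ do rewrite E.
case: (posnP d) => [d0|d0].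
  by have := dinvd; rewrite d0 mulr0 => /esym/eqP; rewrite oner_eq0.
rewrite (bigD1 (Ordinal d0)) //= big1 ?addr0; last first.
  by move=> s; rewrite -val_eqE /= => /negPf->.
by rewrite -rmorphM dinvd rmorph1.
Qed.

Lemma sum_proj : \sum_psi proj psi = 1.
Proof.
rewrite /proj -(bigA_distr_bigA (fun j a => proj1 j a)) big1 // => j _.
exact: sum_proj1.
Qed.

Lemma t_proj1 j a : t j * proj1 j a = c (z ^+ a) * proj1 j a.
Proof.
rewrite /proj1 mulrA -central -mulrA [RHS]mulrA -rmorphM mulrC rmorphM -mulrA; congr (_ * _).
pose F s := c (z ^+ ((d - s) * a)) * t j ^+ s.
have -> : t j * (\sum_(s < d) F s) = c (z ^+ a) * \sum_(s < d) F s.+1.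
  rewrite !mulr_sumr; apply: eq_bigr => s _; rewrite /F mulrA -central -mulrA -exprS.
  by rewrite [RHS]mulrA -rmorphM -exprD -mulSn -subSn // subSS.
congr (_ * _).
have -> : \sum_(s < d) F s.+1 = \sum_(0 <= s < d) F s.+1 by rewrite big_mkord.
have -> : \sum_(s < d) F s = \sum_(0 <= s < d) F s by rewrite big_mkord.
(* The two sums differ by [F d - F 0], which vanishes because [t j ^+ d = 1] and [z ^+ d = 1]. *)
apply/eqP; rewrite -subr_eq0 -sumrB telescope_sumr // /F td subnn mul0n subn0 exprM zd expr1n.
by rewrite !expr0 mulr1 subrr.
Qed.

Lemma t_proj1C j k a : t j * proj1 k a = proj1 k a * t j.
Proof.
rewrite /proj1 mulrA -central -!mulrA; congr (_ * _).
rewrite mulr_sumr mulr_suml; apply: eq_bigr => s _.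
by rewrite mulrA -central -!mulrA; congr (_ * _); apply: commrX; rewrite /GRing.comm tt.
Qed.

Lemma weight_proj (psi : {ffun 'I_n -> 'I_d}) : weight psi (proj psi).
Proof.
move=> j; rewrite /proj; have := mem_index_enum j; elim: (index_enum _) => // k r IHr.
rewrite in_cons !big_cons /= => /orP[/eqP<-|jr]; first by rewrite mulrA t_proj1 -mulrA.
by rewrite mulrA t_proj1C -mulrA (IHr jr) mulrA -central mulrA.
Qed.

Lemma weight_symmetrizer lam i j y : lam (lo i) = lam (hi i) -> lam (lo j) = lam (hi j) ->
  weight lam y -> weight lam (symmetrizer i j * y).
Proof.
have G k x : lam (lo k) = lam (hi k) -> weight lam x -> weight lam (g k * x).
  move=> ck Wx; apply: eq_weight (weight_g k Wx) => a /=.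
  by rewrite /adj; case: tpermP => [->|->|].
move=> ci cj W; rewrite /symmetrizer !mulrDl mul1r -!mulrA.
have Wi := G i _ ci; have Wj := G j _ cj.
by do 5!(apply: weightD; last by auto).
Qed.

Lemma g_inj i x : g i * x = 0 -> x = 0.
Proof.
move=> gx0; have : g i * (g i * x) = 0 by rewrite gx0 mulr0.
rewrite mulrA -expr2 quad mulrDl -!mulrA gx0 !mulr0 addr0 => /(congr1 ( *%R (c qi))).
by rewrite mulr0 mulrA -rmorphM qiq rmorph1 mul1r.
Qed.

(* The relation is only given for the first three strands; multiplication by the
   invertible [g (m+2) * g (m+1) * g m] shifts it by one strand. *)
Lemma symmetrizer_weight0 m (i j : 'I_n.-1) lam y :
  i = m :> nat -> j = m.+1 :> nat ->
  lam (lo i) = lam (hi i) -> lam (lo j) = lam (hi j) ->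
  weight lam y -> symmetrizer i j * y = 0.
Proof.
elim: m i j lam y => [|m IHm] i j lam y im jm ci cj W.
  (* The element [x] has the same weight as [y], so [e i] and [e j] fix it, and [kill] annihilates
     their product with it. *)
  have := weight_symmetrizer ci cj W; set x := _ * y => Wx.
  have ei : e i * x = x by rewrite (weight_e i Wx) ci eqxx.
  have ej : e j * x = x by rewrite (weight_e j Wx) cj eqxx.
  by rewrite -ei -ej mulrA /x mulrA kill // mul0r.
have ltm : (m < n.-1)%N by rewrite (ltn_trans _ (ltn_ord i)) ?im.
pose k := Ordinal ltm.
have hk : hi k = lo i by apply: val_inj; rewrite /= im.
have hil : hi i = lo j by apply: val_inj; rewrite /= im jm.
have jk : (k.+1 < j)%N by rewrite /= jm.
apply: (@g_inj k); apply: (@g_inj i); apply: (@g_inj j); rewrite !mulrA.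
have kj : g k * g j = g j * g k by apply: gg; rewrite jk.
have ki : g k * g i * g k = g i * g k * g i by apply: braid; rewrite im.
have ij : g i * g j * g i = g j * g i * g j by apply: braid; rewrite im jm.
(* With [w = g j * g i * g k] the braid relations give [w * g i = g k * w] and [w * g j = g i * w],
   so [w] moves the symmetrizer one strand down. *)
have ci' : g j * g i * g k * g i = g k * (g j * g i * g k).
  by rewrite -2!(mulrA (g j)) -ki !mulrA kj.
have cj' : g j * g i * g k * g j = g i * (g j * g i * g k).
  by rewrite -mulrA kj mulrA -ij !mulrA.
set w := g j * g i * g k in ci' cj' *.
have -> : w * symmetrizer i j = symmetrizer k i * w.
  have M x1 x2 y1 y2 : w * x1 = x2 * w -> w * y1 = y2 * w -> w * (x1 * y1) = x2 * y2 * w.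
    by move=> h h'; rewrite mulrA h -mulrA h' mulrA.
  rewrite /symmetrizer !mulrDr !mulrDl mulr1 mul1r ci' cj'.
  by rewrite (M _ _ _ _ ci' cj') (M _ _ _ _ cj' ci') (M _ _ _ _ (M _ _ _ _ ci' cj') ci').
rewrite -mulrA; set lam' := lam \o adj k \o adj i \o adj j.
have lamE m' p (lt_m' : (m' < n)%N) (lt_p : (p < n)%N) : (m <= m')%N -> p = m'.+1 ->
    (m' < m.+3)%N -> lam' (Ordinal lt_m') = lam (Ordinal lt_p).
  move=> h1 h2 h3; rewrite /lam' /=; congr lam; apply: val_inj; rewrite /= !adj_val /= im jm.
  by do !case: eqP; lia.
have W' : weight lam' (w * y).
  by rewrite /w -!mulrA; do 3!apply: weight_g.
apply: (IHm k i lam') => //.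
- have -> : lam' (lo k) = lam (lo i) by apply: lamE => /=; lia.
  have -> : lam' (hi k) = lam (hi i) by apply: lamE => /=; lia.
  by [].
- have -> : lam' (lo i) = lam (lo j) by apply: lamE => /=; lia.
  have -> : lam' (hi i) = lam (hi j) by apply: lamE => /=; lia.
  by [].
Qed.

Section FixedRightWeight.
Variable psi : {ffun 'I_n -> 'I_d}.

(* [stdelt g u] exchanges weights, so this is also E_lam * stdelt g u for
   [lam = psi \o u]. *)
Definition belt (u : 'S_n) : B := stdelt g u * proj psi.

Definition coloured_inv (u : 'S_n) := #|inversions (psi \o u) u|.

Lemma belt_desc (u : 'S_n) i : (u (hi i) < u (lo i))%N -> belt u = g i * belt (adj i * u)%g.
Proof. by move=> di; rewrite /belt (stdelt_desc gg braid di) mulrA. Qed.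

Lemma weight_belt (u : 'S_n) : weight (psi \o u) (belt u).
Proof.
elim/reduced_word_ind: u => [|u i di _ IHu].
  by rewrite /belt stdelt1 mul1r; apply: eq_weight (weight_proj psi) => j; rewrite /= perm1.
rewrite (belt_desc di); apply: eq_weight (weight_g i IHu) => j.
by rewrite /= permM adjK.
Qed.

Lemma adj_asc (u : 'S_n) i : ~~ (u (hi i) < u (lo i))%N ->
  ((adj i * u)%g (hi i) < (adj i * u)%g (lo i))%N.
Proof.
rewrite !permM adj_hi adj_lo -leqNgt leq_eqVlt => /orP[/eqP/val_inj/perm_inj h|//].
by have := lo_neq_hi i; rewrite h eqxx.
Qed.

Lemma g_belt (u : 'S_n) i : g i * belt u =
  if (u (hi i) < u (lo i))%N then
    c q * belt (adj i * u)%g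
    + (if psi (u (lo i)) == psi (u (hi i)) then c (q - 1) * belt u else 0)
  else belt (adj i * u)%g.
Proof.
case: ifPn => di; last by rewrite (belt_desc (adj_asc di)) adjV.
rewrite {1}(belt_desc di) mulrA -expr2 quad mulrDl -!mulrA -(belt_desc di).
by rewrite (weight_e i (weight_belt u)) /=; case: ifP; rewrite ?mulr0.
Qed.

Lemma coloured_inv_desc (u : 'S_n) i : (u (hi i) < u (lo i))%N ->
  coloured_inv u = (coloured_inv (adj i * u)%g + (psi (u (lo i)) == psi (u (hi i))))%N.
Proof.
move=> di; rewrite /coloured_inv (card_inversions _ di) /=; congr (_ + _)%N.
by apply: eq_card => -[a b]; rewrite !inE /= !permM.
Qed.

Definition below (u : 'S_n) (y : B) := exists v : 'S_n,
  [/\ y = belt v, psi \o v =1 psi \o u & (coloured_inv v < coloured_inv u)%N].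

(** Exchanging neighbours adds a monochromatic inversion only if they share a colour; the hypothesis
    makes the passage from [adj i * u] to [u] gain one in that case too, so the strict inequality
    survives. *)
Lemma g_below (u : 'S_n) i :
    (psi (u (lo i)) == psi (u (hi i))) ==> (u (hi i) < u (lo i))%N ->
  forall y, lspan c (below (adj i * u)%g) y -> lspan c (below u) (g i * y).
Proof.
move=> same_desc; apply: span_mull => // _ [v [-> vu lt_vu]].
have adj_v : psi \o (adj i * v)%g =1 psi \o u.
  by move=> a; have := vu (adj i a); rewrite /= !permM adjK.
have clo : psi (v (lo i)) = psi (u (hi i)) by have := vu (lo i); rewrite /= permM adj_lo.
have chi : psi (v (hi i)) = psi (u (lo i)) by have := vu (hi i); rewrite /= permM adj_hi.
have inv_v : (coloured_inv (adj i * v)%g <= coloured_inv v + (psi (v (lo i)) == psi (v (hi i))))%N.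
  have [dv|/adj_asc av] := boolP (v (hi i) < v (lo i))%N.
    by rewrite (coloured_inv_desc dv) -addnA leq_addr.
  by rewrite (coloured_inv_desc av) adjV !permM adj_lo adj_hi eq_sym.
have inv_u : (coloured_inv (adj i * u)%g + (psi (u (lo i)) == psi (u (hi i))) <= coloured_inv u)%N.
  have [du|au] := boolP (u (hi i) < u (lo i))%N; first by rewrite (coloured_inv_desc du).
  move: same_desc; rewrite (negPf au) implybF => /negPf h; rewrite h addn0.
  by rewrite (coloured_inv_desc (adj_asc au)) adjV !permM adj_lo adj_hi eq_sym h addn0.
have adj_below : lspan c (below u) (belt (adj i * v)%g).
  apply: span_gen; exists (adj i * v)%g; split=> //.
  by move: inv_v; rewrite clo chi eq_sym; lia.
rewrite g_belt; case: ifP => _ //; apply: spanD; first exact: spanZ.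
rewrite clo chi eq_sym; case: eqP => [cc|_]; last exact: Span0.
apply: spanZ; apply: span_gen; exists v; split=> //.
  by move=> a; rewrite vu /= permM /adj; case: tpermP => [->|->|].
by move: inv_u; rewrite cc eqxx; lia.
Qed.

(** At a descent [belt u] is [g i] times the shorter element. Otherwise the colours differ, [g i]
    times the longer element is [q] times [belt u], and [q] is invertible. *)
Lemma below_step (u : 'S_n) i :
    (psi (u (lo i)) == psi (u (hi i))) ==> (u (hi i) < u (lo i))%N ->
  lspan c (below (adj i * u)%g) (belt (adj i * u)%g) -> lspan c (below u) (belt u).
Proof.
move=> same_desc /(g_below same_desc).
have [du|au] := boolP (u (hi i) < u (lo i))%N; first by rewrite -belt_desc.
rewrite g_belt (adj_asc au) adjV !permM adj_lo adj_hi eq_sym.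
move: same_desc; rewrite (negPf au) implybF => /negPf ->.
by rewrite addr0 => /(spanZ qi); rewrite mulrA -rmorphM qiq rmorph1 mul1r.
Qed.

(* A 321 pattern with gaps is tightened by swapping neighbours which have different
   colours or form an inversion; once its three positions are consecutive, the vanishing
   of the symmetrizer rewrites [belt u] in terms of elements with fewer inversions. *)
Lemma bad_below m (u : 'S_n) (a b k : 'I_n) : (k - a < m)%N -> (a < b < k)%N ->
    psi (u a) = psi (u b) -> psi (u b) = psi (u k) -> (u k < u b < u a)%N ->
  lspan c (below u) (belt u).
Proof.
elim: m u a b k => // m IHm u a b k; rewrite ltnS => le_m /andP[ab bk] ca cb /andP[ukb uba].
have [ab'|ab'] := ltnP a.+1 b.
  have lta : (a < n.-1)%N by rewrite ltn_predRL (leq_trans ab') // ltnW.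
  pose i := Ordinal lta; have li : lo i = a by apply: val_inj.
  have adjb : adj i b = b by apply: adj_id; apply/eqP => /=; lia.
  have adjk : adj i k = k by apply: adj_id; apply/eqP => /=; lia.
  have km : (k - (hi i) < m)%N by rewrite /=; lia.
  (* If [a] and its right neighbour form a monochromatic ascent, the neighbour replaces [a] in the
     pattern; otherwise [below_step] allows the swap. Either way the pattern gets narrower. *)
  have [/andP[/eqP cc uu]|sd] := boolP ((psi (u (lo i)) == psi (u (hi i))) && (u (lo i) < u (hi i))%N).
    apply: (IHm u (hi i) b k) => //; rewrite ?ukb -?ca -?cc ?li //=; first by rewrite ab' bk.
    by rewrite (ltn_trans uba) // -[X in u X]li.
  apply: (@below_step u i).
    apply/implyP => /eqP cc; move: sd; rewrite cc eqxx /= -leqNgt leq_eqVlt.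
    by move=> /orP[/eqP/val_inj/perm_inj h|//]; have := lo_neq_hi i; rewrite h eqxx.
  by apply: (IHm _ (hi i) b k) => //; rewrite ?permM ?adj_hi ?adjb ?adjk ?li ?ukb //= ab' bk.
have [bk'|bk'] := ltnP b.+1 k.
  have ltk : (k.-1 < n.-1)%N by have := ltn_ord k; lia.
  pose i := Ordinal ltk; have hik : hi i = k by apply: val_inj => /=; lia.
  have adjb : adj i b = b by apply: adj_id; apply/eqP => /=; lia.
  have adja : adj i a = a by apply: adj_id; apply/eqP => /=; lia.
  have km : (lo i - a < m)%N by rewrite /=; lia.
  have blo : (b < lo i)%N by rewrite /=; lia.
  have [/andP[/eqP cc uu]|sd] := boolP ((psi (u (lo i)) == psi (u (hi i))) && (u (lo i) < u (hi i))%N).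
    apply: (IHm u a b (lo i)) => //; rewrite ?uba ?ab ?cc ?hik ?andbT //.
    by rewrite (ltn_trans uu) // hik.
  apply: (@below_step u i).
    apply/implyP => /eqP cc; move: sd; rewrite cc eqxx /= -leqNgt leq_eqVlt.
    by move=> /orP[/eqP/val_inj/perm_inj h|//]; have := lo_neq_hi i; rewrite h eqxx.
  by apply: (IHm _ a b (lo i)) => //; rewrite ?permM ?adj_lo ?adjb ?adja ?hik ?ukb ?ab.
have lta : (a < n.-1)%N by have := ltn_ord b; lia.
have ltb : (b < n.-1)%N by have := ltn_ord k; lia.
pose i := Ordinal lta; pose j := Ordinal ltb.
have li : lo i = a by apply: val_inj.
have hib : hi i = b by apply: val_inj => /=; lia.
have lj : lo j = b by apply: val_inj.
have hjk : hi j = k by apply: val_inj => /=; lia.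
have ij : j = i.+1 :> nat by rewrite /=; lia.
have ik : adj i k = k by apply: adj_id; apply/eqP => /=; lia.
have ja : adj j a = a by apply: adj_id; apply/eqP => /=; lia.
have ia : adj i a = b by rewrite -li -hib adj_lo.
have ib : adj i b = a by rewrite -li -hib adj_hi.
have jb : adj j b = k by rewrite -lj -hjk adj_lo.
have jk : adj j k = b by rewrite -lj -hjk adj_hi.
(* [u3] has the three values in increasing order; [u1], [u2] and [v1], [v2] are the intermediate
   arrangements on the two reduced routes from [u] to it. *)
pose u1 := (adj i * u)%g; pose u2 := (adj j * u1)%g; pose u3 := (adj i * u2)%g.
pose v1 := (adj j * u)%g; pose v2 := (adj i * v1)%g.
have v3 : (adj j * v2)%g = u3 by have := congr1 (fun w => (w * u)%g) (adj_braid ij); rewrite -!mulgA => <-.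
have step (w : 'S_n) l : (w (hi l) < w (lo l))%N -> psi (w (lo l)) = psi (w (hi l)) ->
    psi \o w =1 psi \o u -> (coloured_inv w <= coloured_inv u)%N ->
    [/\ g l * belt (adj l * w)%g = belt w, psi \o (adj l * w)%g =1 psi \o u &
     (coloured_inv (adj l * w)%g < coloured_inv u)%N].
  move=> dw cw wu le_wu; rewrite -(belt_desc dw); split=> //.
    by move=> x; rewrite -wu /= permM /adj; case: tpermP => [->|->|].
  by move: le_wu; rewrite (coloured_inv_desc dw) cw eqxx; lia.
have uka : (u k < u a)%N by apply: ltn_trans uba.
have cak : psi (u a) = psi (u k) by rewrite ca.
have u1b : u1 b = u a by rewrite permM ib.
have u1k : u1 k = u k by rewrite permM ik.
have u2a : u2 a = u b by rewrite permM ja permM ia.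
have u2b : u2 b = u k by rewrite permM jb u1k.
have v1a : v1 a = u a by rewrite permM ja.
have v1b : v1 b = u k by rewrite permM jb.
have v2b : v2 b = u a by rewrite permM ib v1a.
have v2k : v2 k = u b by rewrite permM ik permM jk.
have [] := step u i; rewrite ?li ?hib // -/u1 => eu1 cu1 lu1.
have [] := step u1 j; rewrite ?lj ?hjk ?u1b ?u1k ?(ltnW lu1) // -/u2 => eu2 cu2 lu2.
have [] := step u2 i; rewrite ?li ?hib ?u2a ?u2b ?(ltnW lu2) // -/u3 => eu3 cu3 lu3.
have [] := step u j; rewrite ?lj ?hjk // -/v1 => ev1 cv1 lv1.
have [] := step v1 i; rewrite ?li ?hib ?v1a ?v1b ?(ltnW lv1) // -/v2 => ev2 cv2 lv2.
have ev3 : g j * belt u3 = belt v2.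
  by have [] := step v2 j; rewrite ?v3 ?lj ?hjk ?v2b ?v2k ?(ltnW lv2).
have h x : psi (u3 x) = psi (u x) := cu3 x.
have : symmetrizer i j * belt u3 = 0.
  by apply: (symmetrizer_weight0 _ ij _ _ (weight_belt u3)); rewrite //= !h ?li ?hib ?lj ?hjk.
rewrite /symmetrizer !mulrDl mul1r -!mulrA.
rewrite eu3 ev3 ev2 eu2 eu1 => /eqP; rewrite addr_eq0 => /eqP/(congr1 -%R); rewrite opprK => <-.
apply: spanN; do !apply: spanD; apply: span_gen.
by exists u3. by exists u2. by exists v2. by exists v1. by exists u1.
Qed.

Lemma belt_good u : lspan c (fun y => exists2 v, good psi v & y = belt v) (belt u).
Proof.
have [m] := ubnP (coloured_inv u); elim: m u => // m IHm u; rewrite ltnS => le_m.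
have [gu|] := boolP (good psi u); first by apply: span_gen; exists u.
rewrite negb_forall => /existsP[a]; rewrite negb_forall => /existsP[b].
rewrite negb_forall => /existsP[k]; rewrite negb_imply negbK.
case/andP => /and4P[ab bk /eqP ca /eqP cb] /andP[ukb uba].
have B0 := @bad_below (k - a).+1 u a b k (ltnSn _).
apply: span_trans (B0 _ ca cb _); rewrite ?ab ?ukb //.
by move=> _ [v [-> _ lt_v]]; apply: IHm; apply: leq_trans lt_v le_m.
Qed.
End FixedRightWeight.

Definition all_belts y := exists psi u, y = belt psi u.
Definition good_belts y := exists psi u, good psi u /\ y = belt psi u.

(** Used with [span_all_belts_t] and [span_all_belts1]: a span that contains 1 and is stable under
    left multiplication by the generators is the whole algebra. *)
Lemma span_all_belts_g i y : lspan c all_belts y -> lspan c all_belts (g i * y).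
Proof.
apply: span_mull => // _ [psi [u ->]]; rewrite g_belt.
have S v : lspan c all_belts (belt psi v) by apply: span_gen; exists psi, v.
case: ifP => // _; apply: spanD; first exact: spanZ.
by case: ifP => _; [apply: spanZ | apply: Span0].
Qed.

Lemma span_all_belts_t j y : lspan c all_belts y -> lspan c all_belts (t j * y).
Proof.
apply: span_mull => // _ [psi [u ->]]; rewrite (weight_belt psi u j).
by apply: spanZ; apply: span_gen; exists psi, u.
Qed.

Lemma span_all_belts1 : lspan c all_belts 1.
Proof.
rewrite -sum_proj; apply: span_sum => psi _; apply: span_gen.
by exists psi, 1%g; rewrite /belt stdelt1 mul1r.
Qed.

Lemma span_good_belts y : lspan c all_belts y -> lspan c good_belts y.
Proof.
apply: span_trans => // _ [psi [u ->]]; apply: span_trans (belt_good psi u) => //.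
by move=> _ [v gv ->]; apply: span_gen; exists psi, v.
Qed.
End FramedAlgebra.

(** * Laurent scalars, roots of unity and the instantiation to [FTL] *)

Section LaurentScalars.
Variable C : fieldType.

Lemma val_laurent_of_poly (p : {poly C}) : \val (laurent_of_poly p) = ratfun_of_poly p.
Proof. by []. Qed.

Fact laurent_of_poly_is_zmod_morphism : zmod_morphism (@laurent_of_poly C).
Proof. by move=> p r; apply: val_inj; rewrite rmorphB /= rmorphB. Qed.

Fact laurent_of_poly_is_monoid_morphism : monoid_morphism (@laurent_of_poly C).
Proof.
by split=> [|p r]; apply: val_inj; rewrite ?rmorph1 ?rmorphM /= ?rmorph1 ?rmorphM.
Qed.

HB.instance Definition _ := GRing.isZmodMorphism.Build {poly C} (laurent C)
  (@laurent_of_poly C) laurent_of_poly_is_zmod_morphism.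
HB.instance Definition _ := GRing.isMonoidMorphism.Build {poly C} (laurent C)
  (@laurent_of_poly C) laurent_of_poly_is_monoid_morphism.

HB.instance Definition _ := GRing.RMorphism.copy (@laurent_const C)
  (@laurent_of_poly C \o polyC).

Lemma ratfun_of_poly_eq0 (p : {poly C}) : (ratfun_of_poly p == 0) = (p == 0).
Proof. exact: tofrac_eq0. Qed.

Lemma laurent_q_inv : exists qi : laurent C, qi * laurent_q C = 1.
Proof.
have X0 : ratfun_of_poly 'X != 0 :> ratfun C by rewrite ratfun_of_poly_eq0 polyX_eq0.
have P : laurent_pred (ratfun_of_poly 'X : ratfun C)^-1.
  by apply/asboolP; exists 1, 1%N; rewrite expr1 mulVf // rmorph1.
by exists (Laurent P); apply: val_inj; rewrite rmorphM rmorph1 /= mulVf.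
Qed.
End LaurentScalars.

Lemma sum_root_of_unity (F : fieldType) (d : nat) (zeta : F) (k : nat) :
  d.-primitive_root zeta ->
  \sum_(s < d) zeta ^+ (s * k) = if (d %| k)%N then d%:R else 0.
Proof.
move=> prim; under eq_bigr => s _ do rewrite mulnC exprM.
rewrite (prim_order_dvd prim); case: eqP => [->|/eqP ndk].
  by under eq_bigr => s _ do rewrite expr1n; rewrite sumr_const card_ord.
have := subrX1 (zeta ^+ k) d; rewrite -exprM mulnC exprM (prim_expr_order prim) expr1n subrr.
by move/esym/eqP; rewrite mulf_eq0 subr_eq0 (negPf ndk) => /eqP.
Qed.

Lemma laurent_dinv (C : numFieldType) d : (0 < d)%N ->
  laurent_const d%:R^-1 * d%:R = 1 :> laurent C.
Proof.
move=> d0; rewrite -(rmorph_nat (@laurent_const C)) -rmorphM mulVf ?rmorph1 //.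
by rewrite pnatr_eq0 -lt0n.
Qed.

Section LaurentRootOfUnity.
Variables (C : fieldType) (d : nat) (zeta : C).
Hypothesis prim : d.-primitive_root zeta.

Lemma laurent_root : laurent_const zeta ^+ d = 1.
Proof. by rewrite -rmorphXn (prim_expr_order prim) rmorph1. Qed.

Lemma laurent_orthogonality k :
  \sum_(s < d) laurent_const zeta ^+ (s * k) = if (d %| k)%N then d%:R else 0 :> laurent C.
Proof.
under eq_bigr => s _ do rewrite -rmorphXn.
rewrite -rmorph_sum (sum_root_of_unity _ prim); case: ifP => _; first exact: rmorph_nat.
exact: rmorph0.
Qed.
End LaurentRootOfUnity.

Lemma malgC_comm (A : comNzRingType) (K : monomType) (a : A) (x : {malg A[K]}) :
  a%:MP * x = x * a%:MP.
Proof.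
rewrite [x]monalgE mulr_sumr mulr_suml; apply: eq_bigr => k _.
by rewrite !malgM_def !fgmulUU mul1m mulm1 mulrC.
Qed.

Lemma rmorph_idem_e (B B' : pzRingType) (f : {rmorphism B -> B'}) d n (x : B) (t : 'I_n -> B) i :
  f (idem_e d x t i) = idem_e d (f x) (f \o t) i.
Proof.
rewrite /idem_e rmorphM rmorph_sum; congr (_ * _); apply: eq_bigr => s _.
by rewrite rmorphM !rmorphXn.
Qed.

Lemma rmorph_symmetrizer (B B' : pzRingType) (f : {rmorphism B -> B'}) (a b x y : B) :
  f (a * b * (1 + x + y + x * y + y * x + x * y * x)) =
  f a * f b * (1 + f x + f y + f x * f y + f y * f x + f x * f y * f x).
Proof. by rewrite !(rmorphM, rmorphD, rmorph1). Qed.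

Lemma rmorph_braid (B B' : pzRingType) (f : {rmorphism B -> B'}) (x y : B) :
  f (x * y * x) = f x * f y * f x.
Proof. by rewrite !rmorphM. Qed.

Lemma rmorph_quad (B B' : pzRingType) (f : {rmorphism B -> B'}) (a b x y : B) :
  f (a + b * (x * y)) = f a + f b * (f x * f y).
Proof. by rewrite rmorphD !rmorphM. Qed.

Section SpanningSet.
Variables (C : numFieldType) (d n : nat).

Local Notation A := (laurent C).
Local Notation FTL := (FTL C d n).

HB.instance Definition _ := GRing.RMorphism.copy (@yh_pi C d n) (@quot_pi _ _).
HB.instance Definition _ := GRing.RMorphism.copy (@ftl_pi C d n) (@quot_pi _ _).

Definition free_ftl (x : yhFree C n) : FTL := ftl_pi (yh_pi d x).

HB.instance Definition _ := GRing.RMorphism.copy free_ftl (@ftl_pi C d n \o @yh_pi C d n).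

Definition ftl_g (i : 'I_n.-1) : FTL := free_ftl (free_g C i).
Definition ftl_t (j : 'I_n) : FTL := free_ftl (free_t C j).
Definition ftl_e (i : 'I_n.-1) : FTL := free_ftl (free_e C d i).

Lemma free_ftl_surj (x : FTL) : exists y, free_ftl y = x.
Proof.
have [y <-] := quot_surj x; have [w <-] := quot_surj y.
by exists w.
Qed.

Lemma ftl_c_central (a : A) (x : FTL) : ftl_c d n a * x = x * ftl_c d n a.
Proof.
have [y <-] := free_ftl_surj x; rewrite -[ftl_c _ _ _]/(free_ftl (free_c n a)).
by rewrite -!rmorphM /free_c malgC_comm.
Qed.

Lemma ftl_relation (x y : yhFree C n) : yh_rel d (x - y) -> free_ftl x = free_ftl y.
Proof. by move=> r; congr ftl_pi; apply: (iffRL (@quot_eqP _ (@yh_rel C d n) x y)); apply: Ideal_gen. Qed.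

Lemma ftl_eE i : ftl_e i = idem_e d (ftl_c d n (laurent_const d%:R^-1)) ftl_t i.
Proof. exact: rmorph_idem_e. Qed.

Lemma ftl_pi_eq0 (x : YH C d n) : ftl_rel x -> ftl_pi x = 0.
Proof.
move=> r; rewrite -(rmorph0 (@ftl_pi C d n)).
by apply: (iffRL (@quot_eqP _ (@ftl_rel C d n) x 0)); rewrite subr0; apply: Ideal_gen.
Qed.

Lemma ftl_kill (i j : 'I_n.-1) : i = 0%N :> nat -> j = 1%N :> nat ->
  ftl_e i * ftl_e j * symmetrizer ftl_g i j = 0.
Proof.
move=> i0 j1; have := ftl_pi_eq0 (@FTL_rel C d n i j i0 j1).
have E k : ftl_e k = ftl_pi (yh_e C d k).
  by rewrite ftl_eE [in RHS]rmorph_idem_e.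
by rewrite rmorph_symmetrizer !E.
Qed.

Section Span.
Variable zeta : C.
Hypotheses (d_gt0 : (0 < d)%N) (prim : d.-primitive_root zeta).

Definition ftl_belt (psi : {ffun 'I_n -> 'I_d}) (u : 'S_n) : FTL :=
  belt (ftl_c d n) (laurent_const zeta) (laurent_const d%:R^-1) ftl_g ftl_t psi u.

Lemma ftl_span (x : FTL) :
  lspan (ftl_c d n) (fun y => exists psi u, good psi u /\ y = ftl_belt psi u) x.
Proof.
have [qi qiq] := laurent_q_inv C.
have dinvd := laurent_dinv C d_gt0.
have zd := laurent_root prim; have orth := laurent_orthogonality prim.
have gg (i j : 'I_n.-1) : (i.+1 < j)%N || (j.+1 < i)%N -> ftl_g i * ftl_g j = ftl_g j * ftl_g i.
  move=> ij; rewrite -[LHS](rmorphM free_ftl) -[RHS](rmorphM free_ftl).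
  by apply: ftl_relation; apply: YH_gg.
have braid (i j : 'I_n.-1) : j = i.+1 :> nat -> ftl_g i * ftl_g j * ftl_g i = ftl_g j * ftl_g i * ftl_g j.
  move=> ij; rewrite -[LHS](rmorph_braid free_ftl) -[RHS](rmorph_braid free_ftl).
  by apply: ftl_relation; apply: YH_braid.
have tt i j : ftl_t i * ftl_t j = ftl_t j * ftl_t i.
  rewrite -[LHS](rmorphM free_ftl) -[RHS](rmorphM free_ftl).
  by apply: ftl_relation; apply: YH_tt.
have tg i j : ftl_t j * ftl_g i = ftl_g i * ftl_t (adj i j).
  rewrite -[LHS](rmorphM free_ftl) -[RHS](rmorphM free_ftl).
  by apply: ftl_relation; apply: YH_tg.
have td j : ftl_t j ^+ d = 1.
  rewrite -[LHS](rmorphXn free_ftl) -[RHS](rmorph1 free_ftl).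
  by apply: ftl_relation; apply: YH_td.
have quad i : ftl_g i ^+ 2 = ftl_c d n (laurent_q C) + ftl_c d n (laurent_q C - 1) * (ftl_e i * ftl_g i).
  rewrite -[LHS](rmorphXn free_ftl) -[RHS](rmorph_quad free_ftl).
  by apply: ftl_relation; apply: YH_quad.
have cen := ftl_c_central.
apply: (span_good_belts cen qiq dinvd zd orth ftl_eE gg braid tt tg td quad ftl_kill).
set S := all_belts _ _ _ _ _ _.
have S1 : lspan (ftl_c d n) S 1 by apply: span_all_belts1.
have Sg := span_all_belts_g cen dinvd zd orth ftl_eE gg braid tt tg td quad.
have St := @span_all_belts_t _ _ _ cen _ _ _ (laurent_const d%:R^-1) zd _ _ gg braid tt tg td.
have [y <-] := free_ftl_surj x.
rewrite [y]monalgE rmorph_sum; apply: span_sum => -[m] _.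
have -> : (<< y@_(FMonom m) *g FMonom m >> : yhFree C n) = free_c n y@_(FMonom m) * << FMonom m >>.
  by rewrite /free_c malgM_def fgmulUU mulr1 mul1m.
rewrite (rmorphM free_ftl (free_c n _)); apply: spanZ.
elim: m => [|[i|j] m IHm].
- have -> : (<< FMonom [::] >> : yhFree C n) = 1 by rewrite -fmoneE.
  by rewrite (rmorph1 free_ftl).
- have -> : (<< FMonom (inl i :: m) >> : yhFree C n) = free_g C i * << FMonom m >>.
    by rewrite /free_g malgM_def fgmulUU mulr1 fmuE -[RHS]/(<< fmmul _ _ >>) fmmulE.
  by rewrite (rmorphM free_ftl (free_g C i)); apply: Sg.
- have -> : (<< FMonom (inr j :: m) >> : yhFree C n) = free_t C j * << FMonom m >>.
    by rewrite /free_t malgM_def fgmulUU mulr1 fmuE -[RHS]/(<< fmmul _ _ >>) fmmulE.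
  by rewrite (rmorphM free_ftl (free_t C j)); apply: St.
Qed.
End Span.
End SpanningSet.

(** * The action on tensor space *)

Section LocalOperators.
Variables (d : nat) (R : comNzRingType) (q : R).
Local Notation label := ('I_d * bool)%type.
Implicit Types (a b c : label) (v w : R) (f : label -> label -> label -> R).

(** Lexicographic with the colour first: the two labels of a colour are consecutive, and half the
    code is the colour. *)
Definition code a : nat := (a.1.*2 + a.2)%N.

Lemma code_half a b : ((code a)./2 == (code b)./2) = (a.1 == b.1).
Proof. by rewrite /code ![(_.*2 + _)%N]addnC !half_bit_double. Qed.

Lemma code_inj : injective code.
Proof.
move=> [a x] [b y] E.
have ab : a = b by apply/eqP; rewrite -[_ == _](code_half (a, x) (b, y)) E.
by move: E; rewrite /code ab /= => /addnI; case: x y => -[].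
Qed.

(* The coefficient at [.. a b ..] of the image under [g_i] of a function taking the
   values [v] at [.. a b ..] and [w] at [.. b a ..]. Equal labels get the eigenvalue [-1],
   not [q], so that with two labels per colour the symmetrizer vanishes. *)
Definition local_op a b v w : R :=
  if a == b then - v else
  if (code a < code b)%N then - w else - (q * w) + (if a.1 == b.1 then (q - 1) * v else 0).

Definition op12 f a b c := local_op a b (f a b c) (f b a c).
Definition op23 f a b c := local_op b c (f a b c) (f a c b).

Lemma local_op_eq a v w : local_op a a v w = - v.
Proof. by rewrite /local_op eqxx. Qed.

Lemma local_op_lt a b v w : (code a < code b)%N -> local_op a b v w = - w.
Proof. by move=> ab; rewrite /local_op ab; case: eqP ab => // ->; rewrite ltnn. Qed.

Lemma local_op_gt a b v w : (code b < code a)%N ->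
  local_op a b v w = - (q * w) + (a.1 == b.1)%:R * (q - 1) * v.
Proof.
move=> ab; rewrite /local_op ltnNge (ltnW ab) /=.
case: eqP ab => [->|_ _]; first by rewrite ltnn.
by case: ifP; rewrite ?mul1r ?mul0r.
Qed.

Lemma op_braid f a b c : op12 (op23 (op12 f)) a b c = op23 (op12 (op23 f)) a b c.
Proof.
(* Written through codes, equality of colours is visible to [lia], which discards the colour
   patterns incompatible with the order of the labels. *)
have S x y : x.1 == y.1 = ((code x)./2 == (code y)./2) by rewrite code_half.
rewrite /op12 /op23.
case: (ltngtP (code a) (code b)) => [ab|ab|/code_inj ab];
case: (ltngtP (code b) (code c)) => [bc|bc|/code_inj bc];
case: (ltngtP (code a) (code c)) => [ac|ac|/code_inj ac];
 try (exfalso; subst; lia); subst;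
 rewrite ?local_op_eq;
 do ?[rewrite (local_op_lt _ _ ab)|rewrite (local_op_lt _ _ bc)|rewrite (local_op_lt _ _ ac)
  |rewrite (local_op_gt _ _ ab)|rewrite (local_op_gt _ _ bc)|rewrite (local_op_gt _ _ ac)];
 rewrite ?local_op_eq; do ?rewrite S; do ?case: eqP => ?; try (exfalso; lia); rewrite /=; ring.
Qed.

Lemma local_op_quad a b v w :
  local_op a b (local_op a b v w) (local_op b a w v)
    = q * v + (a.1 == b.1)%:R * (q - 1) * local_op a b v w.
Proof.
case: (ltngtP (code a) (code b)) => [ab|ab|/code_inj->].
- by rewrite !(local_op_lt _ _ ab) !(local_op_gt _ _ ab) (eq_sym b.1); ring.
- by rewrite !(local_op_gt _ _ ab) !(local_op_lt _ _ ab); ring.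
- by rewrite !local_op_eq eqxx /=; ring.
Qed.

(** With eigenvalue [-1] on equal labels, the symmetrizer acts on one colour as a quantum
    antisymmetrizer of degree three on a two-dimensional space, hence as zero. *)
Lemma op_symmetrizer f a b c : a.1 = b.1 -> b.1 = c.1 ->
  f a b c + op12 f a b c + op23 f a b c + op12 (op23 f) a b c + op23 (op12 f) a b c
    + op12 (op23 (op12 f)) a b c = 0.
Proof.
case: a b c => [i x] [j y] [k z] /= -> ->; rewrite /op12 /op23 /local_op /code !xpair_eqE !eqxx /=.
by case: x y z => -[] [] /=; rewrite ?addn0 ?addn1 ?ltnn ?ltnSn ?[(_.+1 < _)%N]ltnNge ?leqnSn /=; ring.
Qed.
End LocalOperators.

(** At [q = 1] the operator is minus the flip. For equal labels this needs [v = w], which holds in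
    use because the swap then fixes the word. *)
Lemma local_op1 (d : nat) (R : comNzRingType) (a b : 'I_d * bool) (v w : R) :
  (a = b -> v = w) -> local_op 1 a b v w = - w.
Proof.
move=> vw; rewrite /local_op; case: eqP => [/vw->//|_]; case: ifP => // _.
by rewrite subrr mul0r if_same addr0 mul1r.
Qed.

Lemma local_op_linear (d : nat) (R : comNzRingType) (q : R) (a b : 'I_d * bool) :
  exists s t, forall v w, local_op q a b v w = s * v + t * w.
Proof.
rewrite /local_op; case: (a == b); first by exists (-1), 0 => v w; ring.
case: (code a < code b)%N; first by exists 0, (-1) => v w; ring.
case: (a.1 == b.1); first by exists (q - 1), (- q) => v w; ring.
by exists 0, (- q) => v w; ring.
Qed.

Lemma rmorph_local_op (d : nat) (R R' : comNzRingType) (h : {rmorphism R -> R'}) q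
    (a b : 'I_d * bool) v w :
  h (local_op q a b v w) = local_op (h q) a b (h v) (h w).
Proof.
rewrite /local_op; case: ifP => _; first by rewrite rmorphN.
case: ifP => _; first by rewrite rmorphN.
by case: ifP => _; rewrite !(rmorphD, rmorphN, rmorphM, rmorph1, rmorph0).
Qed.

Section TensorOperators.
Variables (d n : nat) (R : comNzRingType).
Local Notation words := {ffun 'I_n -> 'I_d * bool}.
Local Notation V := {ffun words -> R^o}.
Variable q : R.
Implicit Types (x : words) (v : V).

Definition swap (i : 'I_n.-1) x : words := [ffun k => x (adj i k)].

Definition op_g i v : V :=
  [ffun x : words => local_op q (x (lo i)) (x (hi i)) (v x) (v (swap i x))].

Definition op_t (z : R) j v : V := [ffun x : words => z ^+ (x j).1 * v x].

Fact op_g_is_linear i : linear (op_g i).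
Proof.
move=> a v w; apply/ffunP => x; rewrite !ffunE.
by have [s [t E]] := local_op_linear q (x (lo i)) (x (hi i)); rewrite !E /GRing.scale /=; ring.
Qed.

Fact op_t_is_linear z j : linear (op_t z j).
Proof. by move=> a v w; apply/ffunP => x; rewrite !ffunE /GRing.scale /=; ring. Qed.

HB.instance Definition _ i := GRing.isLinear.Build R V V _ (op_g i) (op_g_is_linear i).
HB.instance Definition _ z j := GRing.isLinear.Build R V V _ (op_t z j) (op_t_is_linear z j).

Lemma swapK i x : swap i (swap i x) = x.
Proof. by apply/ffunP => k; rewrite !ffunE adjK. Qed.

Lemma op_gg (i j : 'I_n.-1) v : (i.+1 < j)%N || (j.+1 < i)%N -> op_g i (op_g j v) = op_g j (op_g i v).
Proof.
move=> ij; apply/ffunP => x; rewrite !ffunE.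
have E (k l : 'I_n.-1) (kl : (k.+1 < l)%N || (l.+1 < k)%N) :
    adj k (lo l) = lo l /\ adj k (hi l) = hi l.
  by split; apply: adj_id; apply/eqP => /=; lia.
have [ijl ijh] := E i j ij; have [jil jih] := E j i (etrans (orbC _ _) ij).
have -> : swap j (swap i x) = swap i (swap j x).
  apply/ffunP => k; rewrite !ffunE; congr (x _).
  by have := congr1 (fun s : 'S_n => s k) (adj_far ij); rewrite !permM.
rewrite ijl ijh jil jih.
have [a [b Ei]] := local_op_linear q (x (lo i)) (x (hi i)).
have [a' [b' Ej]] := local_op_linear q (x (lo j)) (x (hi j)).
by rewrite !Ei !Ej; ring.
Qed.

Section ThreeStrands.
Variables (i j : 'I_n.-1) (ij : j = i.+1 :> nat).

(** Freezing [x] outside three strands turns functions on words into functions of three labels, on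
    which [op_g i] and [op_g j] become [op12] and [op23]. *)
Definition put x (a b c : 'I_d * bool) : words := [ffun k =>
  if k == lo i then a else if k == hi i then b else if k == hi j then c else x k].

Let hil : hi i = lo j. Proof. by apply: val_inj; rewrite /= ij. Qed.
Let neq : (hi i != lo i) && (hi j != lo i) && (hi j != hi i).
Proof. by rewrite -!val_eqE /= ij; lia. Qed.

Lemma put_lo x a b c : put x a b c (lo i) = a.
Proof. by rewrite ffunE eqxx. Qed.

Lemma put_mid x a b c : put x a b c (hi i) = b.
Proof. by case/andP: neq => /andP[/negPf h _] _; rewrite ffunE h eqxx. Qed.

Lemma put_hi x a b c : put x a b c (hi j) = c.
Proof. by case/andP: neq => /andP[_ /negPf h] /negPf h'; rewrite ffunE h h' eqxx. Qed.

Lemma put_id x : put x (x (lo i)) (x (hi i)) (x (hi j)) = x.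
Proof. by apply/ffunP => k; rewrite ffunE; do !case: eqP => [->|] //. Qed.

Lemma swap_put12 x a b c : swap i (put x a b c) = put x b a c.
Proof.
apply/ffunP => k; rewrite ffunE /adj; case: tpermP => [->|->|/eqP h1 /eqP h2].
- by rewrite put_mid put_lo.
- by rewrite put_mid put_lo.
- by rewrite !ffunE (negPf h1) (negPf h2).
Qed.

Lemma swap_put23 x a b c : swap j (put x a b c) = put x a c b.
Proof.
apply/ffunP => k; rewrite ffunE /adj -hil; case: tpermP => [->|->|/eqP h1 /eqP h2].
- by rewrite put_mid put_hi.
- by rewrite put_mid put_hi.
- by rewrite !ffunE (negPf h1) (negPf h2).
Qed.

Lemma op_g_put12 v x a b c :
  op_g i v (put x a b c) = op12 q (fun a b c => v (put x a b c)) a b c.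
Proof. by rewrite ffunE put_lo put_mid swap_put12. Qed.

Lemma op_g_put23 v x a b c :
  op_g j v (put x a b c) = op23 q (fun a b c => v (put x a b c)) a b c.
Proof. by rewrite ffunE -hil put_mid put_hi swap_put23. Qed.

Lemma op12_ext (f f' : 'I_d * bool -> 'I_d * bool -> 'I_d * bool -> R) a b c : (forall a b c, f a b c = f' a b c) ->
  op12 q f a b c = op12 q f' a b c :> R.
Proof. by move=> E; rewrite /op12 !E. Qed.

Lemma op23_ext (f f' : 'I_d * bool -> 'I_d * bool -> 'I_d * bool -> R) a b c : (forall a b c, f a b c = f' a b c) ->
  op23 q f a b c = op23 q f' a b c :> R.
Proof. by move=> E; rewrite /op23 !E. Qed.

Lemma op_g_braid v : op_g i (op_g j (op_g i v)) = op_g j (op_g i (op_g j v)).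
Proof.
apply/ffunP => x; rewrite -(put_id x) op_g_put12 [RHS]op_g_put23.
set F := fun a b c => v (put x a b c).
transitivity (op12 q (op23 q (op12 q F)) (x (lo i)) (x (hi i)) (x (hi j))).
  apply: op12_ext => a b c; rewrite op_g_put23; apply: op23_ext => {a b c} a b c.
  by rewrite op_g_put12.
rewrite op_braid; apply: op23_ext => a b c; rewrite op_g_put12.
by apply: op12_ext => {a b c} a b c; rewrite op_g_put23.
Qed.

Lemma op_g_symmetrizer v x :
    (x (lo i)).1 = (x (hi i)).1 -> (x (lo j)).1 = (x (hi j)).1 ->
  v x + op_g i v x + op_g j v x + op_g i (op_g j v) x + op_g j (op_g i v) x
    + op_g i (op_g j (op_g i v)) x = 0.
Proof.
rewrite -hil => c1 c2; rewrite -(op_symmetrizer q (fun a b c => v (put x a b c)) c1 c2).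
rewrite -[in LHS](put_id x); set a := x (lo i); set b := x (hi i); set c := x (hi j).
rewrite !op_g_put12 !op_g_put23.
congr (_ + _ + _ + _ + _ + _).
- by apply: op12_ext => {}a {}b {}c; rewrite op_g_put23.
- by apply: op23_ext => {}a {}b {}c; rewrite op_g_put12.
apply: op12_ext => {}a {}b {}c; rewrite op_g_put23; apply: op23_ext => {}a {}b {}c.
by rewrite op_g_put12.
Qed.
End ThreeStrands.

Lemma op_g_quad i v x :
  op_g i (op_g i v) x = q * v x + ((x (lo i)).1 == (x (hi i)).1)%:R * (q - 1) * op_g i v x.
Proof.
have gE y : op_g i v y = local_op q (y (lo i)) (y (hi i)) (v y) (v (swap i y)) by rewrite ffunE.
rewrite [LHS]ffunE !gE swapK [swap i x (lo i)]ffunE [swap i x (hi i)]ffunE adj_lo adj_hi.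
exact: local_op_quad.
Qed.

Lemma op_tg z i j v : op_t z j (op_g i v) = op_g i (op_t z (adj i j) v).
Proof.
apply/ffunP => x; rewrite !ffunE adjK /local_op.
case: ifP => [/eqP E|_].
  suff -> : x (adj i j) = x j by ring.
  by rewrite /adj; case: tpermP => [->|->|].
case: ifP => _; first by ring.
case: ifP => [/eqP E|_]; last by ring.
suff -> : (x (adj i j)).1 = (x j).1 by ring.
by rewrite /adj; case: tpermP => [->|->|].
Qed.
End TensorOperators.

(** * Actions of free algebras and of their quotients *)

Section Actions.

Definition action (B : pzRingType) (V : zmodType) (act : B -> V -> V) :=
  [/\ forall v, act 1 v = v,
      forall x y v, act (x * y) v = act x (act y v),
      forall x y v, act (x - y) v = act x v - act y v &
      forall x v w, act x (v - w) = act x v - act x w].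

Section ActionTheory.
Variables (B : pzRingType) (V : zmodType) (act : B -> V -> V) (act_ok : action act).

Lemma action1 v : act 1 v = v. Proof. by case: act_ok. Qed.
Lemma actionM x y v : act (x * y) v = act x (act y v). Proof. by case: act_ok. Qed.
Lemma actionBl x y v : act (x - y) v = act x v - act y v. Proof. by case: act_ok. Qed.
Lemma actionBr x v w : act x (v - w) = act x v - act x w. Proof. by case: act_ok. Qed.
Lemma action0l v : act 0 v = 0. Proof. by have := actionBl 0 0 v; rewrite !subrr. Qed.
Lemma action0r x : act x 0 = 0. Proof. by have := actionBr x 0 0; rewrite !subrr. Qed.
Lemma actionDl x y v : act (x + y) v = act x v + act y v.
Proof.
have actN w : act (- w) v = - act w v by rewrite -[- w]sub0r actionBl action0l sub0r.
by rewrite -{1}[y]opprK actionBl actN opprK.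
Qed.
Lemma actionX x m v : act (x ^+ m) v = iter m (act x) v.
Proof. by elim: m v => [|m IHm] v; rewrite ?expr0 ?action1 // exprS actionM IHm. Qed.
Lemma action_sum (I : Type) (r : seq I) (P : pred I) (F : I -> B) v :
  act (\sum_(i <- r | P i) F i) v = \sum_(i <- r | P i) act (F i) v.
Proof.
by elim/big_rec2: _ => [|i y x _ <-]; rewrite ?action0l ?actionDl.
Qed.
Lemma action_prod (I : Type) (r : seq I) (F : I -> B) v :
  act (\prod_(i <- r) F i) v = foldr (fun i => act (F i)) v r.
Proof. by elim: r => [|i r IHr]; rewrite ?big_nil ?action1 // big_cons actionM IHr. Qed.

(** Serves twice, from the free algebra to [YH] and from [YH] to [FTL]. The action goes through
    representatives, whose choice only matters up to elements acting as zero. *)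
Lemma action_quot (S : B -> Prop) : (forall s, S s -> forall v, act s v = 0) ->
  exists act' : quotRing S -> V -> V,
    action act' /\ forall x v, act' (quot_pi S x) v = act x v.
Proof.
move=> killS; have kill x : ideal_gen S x -> forall v, act x v = 0.
  elim=> {x} [x /killS //|v|x y _ Ix _ Iy v|a x _ Ix v|x a _ Ix v].
  - exact: action0l.
  - by rewrite actionBl Ix Iy subrr.
  - by rewrite actionM Ix action0r.
  - by rewrite actionM Ix.
have E x v : act (repr (quot_pi S x : Quotient.quot (ideal_pred S))) v = act x v.
  apply/eqP; rewrite -subr_eq0 -actionBl kill //.
  by apply: (iffLR (@quot_eqP _ S _ x)); apply: quot_repK.
exists (fun u => act (repr (u : Quotient.quot (ideal_pred S)))); split=> //.
split=> [v|u u' v|u u' v|u v w].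
- by rewrite -[1]/(quot_pi S 1) E action1.
- have [x <-] := quot_surj u; have [y <-] := quot_surj u'.
  by rewrite -(rmorphM (quot_pi S)) !E actionM.
- have [x <-] := quot_surj u; have [y <-] := quot_surj u'.
  by rewrite -(raddfB (quot_pi S)) !E actionBl.
- by have [x <-] := quot_surj u; rewrite !E actionBr.
Qed.
End ActionTheory.
End Actions.

Section FreeAction.
Variables (A : comNzRingType) (G : choiceType) (V : lmodType A).
Variable op : G -> {linear V -> V}.
Local Notation Z := {malg A[{fmonom G}]}.

Definition word_action (m : {fmonom G}) (v : V) := foldr (fun s => op s) v m.

Definition free_action (x : Z) (v : V) := \sum_(m <- msupp x) x@_m *: word_action m v.

Fact word_action_is_linear m : linear (word_action m).
Proof.
move=> a v w; rewrite /word_action; elim: (m : seq G) => //= s r ->.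
by rewrite linearP.
Qed.

HB.instance Definition _ m := GRing.isLinear.Build A V V _ (word_action m) (word_action_is_linear m).

Lemma free_actionEw (E : {fset {fmonom G}}) (x : Z) v : (msupp x `<=` E)%fset ->
  free_action x v = \sum_(m <- E) x@_m *: word_action m v.
Proof.
move=> le; rewrite [LHS](big_fset_incl _ le) //= => m _ /mcoeff_outdom ->.
by rewrite scale0r.
Qed.

Lemma free_actionU a m v : free_action << a *g m >> v = a *: word_action m v.
Proof. by rewrite (@free_actionEw [fset m]%fset) ?msuppU_le // big_seq_fset1 mcoeffUU. Qed.

Lemma free_actionB x y v : free_action (x - y) v = free_action x v - free_action y v.
Proof.
pose E := (msupp x `|` (msupp y `|` msupp (x - y)))%fset.
rewrite !(@free_actionEw E) ?fsubsetUl //; first last.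
- by apply: fsubset_trans (fsubsetUr _ _); apply: fsubsetUr.
- by apply: fsubset_trans (fsubsetUr _ _); apply: fsubsetUl.
by rewrite -sumrB; apply: eq_bigr => m _; rewrite mcoeffB scalerBl.
Qed.

Lemma free_action_sum (I : Type) (r : seq I) (F : I -> Z) v :
  free_action (\sum_(i <- r) F i) v = \sum_(i <- r) free_action (F i) v.
Proof.
have A0 : free_action 0 v = 0 by have := free_actionB 0 0 v; rewrite !subrr.
have AN y : free_action (- y) v = - free_action y v.
  by rewrite -[- y]sub0r free_actionB A0 sub0r.
elim: r => [|i r IHr]; first by rewrite !big_nil.
by rewrite !big_cons -IHr -{1}[\sum_(_ <- _) _]opprK free_actionB AN opprK.
Qed.

Lemma free_action_action : action free_action.
Proof.
have word1 v : word_action mone v = v by rewrite /word_action fm1.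
split=> [v|x y v|x y v|x v w].
- by rewrite free_actionU scale1r word1.
- rewrite {1}[x]monalgE mulr_suml free_action_sum; apply: eq_bigr => m _.
  rewrite {1}[y]monalgE mulr_sumr free_action_sum linear_sum scaler_sumr.
  apply: eq_bigr => m' _; rewrite malgM_def fgmulUU free_actionU.
  rewrite linearZ scalerA; congr (_ *: _).
  by rewrite /= /word_action fmM foldr_cat.
- exact: free_actionB.
- by rewrite /free_action -sumrB; apply: eq_bigr => m _; rewrite linearB scalerBr.
Qed.

Lemma free_action_gen s v : free_action << fmu s >> v = op s v.
Proof. by rewrite free_actionU scale1r /word_action fmU. Qed.

Lemma free_action_scalar a v : free_action a%:MP v = a *: v.
Proof. by rewrite free_actionU /word_action fm1. Qed.
End FreeAction.

Section TensorAction.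
Variables (A : comNzRingType) (d n : nat) (q z dinv : A).
Hypotheses (dinvd : dinv * d%:R = 1) (zd : z ^+ d = 1).
Hypothesis orth : forall k, \sum_(s < d) z ^+ (s * k) = if (d %| k)%N then d%:R else 0.

Local Notation words := {ffun 'I_n -> 'I_d * bool}.
Local Notation V := {ffun words -> A^o}.

Lemma iter_op_t j m v (x : words) : iter m (op_t z j) v x = z ^+ (m * (x j).1) * v x.
Proof.
elim: m => [|m IHm]; first by rewrite mul0n expr0 mul1r.
by rewrite iterS ffunE IHm mulrA -exprD.
Qed.

Definition restrict_colour (R : comNzRingType) (psi : {ffun 'I_n -> 'I_d})
    (v : {ffun words -> R^o}) : {ffun words -> R^o} :=
  [ffun x : words => if [forall k, (x k).1 == psi k] then v x else 0 : R^o].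

Variables (B : pzRingType) (act : B -> V -> V) (c : A -> B) (g : 'I_n.-1 -> B) (t : 'I_n -> B).

(** The relations are verified from these four facts alone, so the same lemmas serve both the free
    algebra and [YH]. *)
Definition tensor_action := [/\ action act, forall a v, act (c a) v = a *: v,
  forall i v, act (g i) v = op_g q i v & forall j v, act (t j) v = op_t z j v].

Hypothesis actP : tensor_action.
Let act_ok : action act. Proof. by case: actP. Qed.
Let actc a v : act (c a) v = a *: v. Proof. by case: actP. Qed.
Let actg i v : act (g i) v = op_g q i v. Proof. by case: actP. Qed.
Let actt j v : act (t j) v = op_t z j v. Proof. by case: actP. Qed.

Let acttX j s v : act (t j ^+ s) v = iter s (op_t z j) v.
Proof. by rewrite (actionX act_ok); apply: eq_iter => w; rewrite actt. Qed.

Lemma act_gg (i j : 'I_n.-1) v : (i.+1 < j)%N || (j.+1 < i)%N ->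
  act (g i * g j) v = act (g j * g i) v.
Proof. by move=> ij; rewrite !(actionM act_ok) !actg op_gg. Qed.

Lemma act_braid (i j : 'I_n.-1) v : j = i.+1 :> nat ->
  act (g i * g j * g i) v = act (g j * g i * g j) v.
Proof. by move=> ij; rewrite !(actionM act_ok) !actg op_g_braid. Qed.

Lemma act_tt i j v : act (t i * t j) v = act (t j * t i) v.
Proof.
rewrite !(actionM act_ok) !actt; apply/ffunP => x; rewrite !ffunE.
by rewrite !mulrA [X in X * _]mulrC.
Qed.

Lemma act_tg i j v : act (t j * g i) v = act (g i * t (adj i j)) v.
Proof. by rewrite !(actionM act_ok) !actg !actt op_tg. Qed.

Lemma act_td j v : act (t j ^+ d) v = act 1 v.
Proof.
by rewrite acttX (action1 act_ok); apply/ffunP => x; rewrite iter_op_t exprM zd expr1n mul1r.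
Qed.

Local Notation e i := (idem_e d (c dinv) t i).

Lemma act_e i v (x : words) : act (e i) v x = ((x (lo i)).1 == (x (hi i)).1)%:R * v x.
Proof.
rewrite /idem_e (actionM act_ok) actc (action_sum act_ok).
rewrite -(root_orthogonality dinvd zd orth) ffunE sum_ffunE -mulrA [RHS]mulrA.
rewrite /GRing.scale /= -mulrA mulr_suml; congr (_ * _); apply: eq_bigr => s _.
by rewrite (actionM act_ok) !acttX !iter_op_t mulrA -exprD.
Qed.

Lemma act_quad i v : act (g i ^+ 2) v = act (c q + c (q - 1) * (e i * g i)) v.
Proof.
rewrite expr2 (actionDl act_ok) !(actionM act_ok (g i)) (actionM act_ok (c _)).
rewrite (actionM act_ok (e i)) !actc !actg; apply/ffunP => x.
have DE (w w' : V) : (w + w') x = w x + w' x by rewrite ffunE.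
have ZE (a : A) (w : V) : (a *: w) x = a * w x by rewrite ffunE.
by rewrite op_g_quad DE !ZE act_e mulrA [(q - 1) * _]mulrC.
Qed.

(** The idempotents cut down to words whose three labels share a colour, where [op_g_symmetrizer]
    applies. *)
Lemma act_symmetrizer (i j : 'I_n.-1) v : j = i.+1 :> nat ->
  act (e i * e j * (1 + g i + g j + g i * g j + g j * g i + g i * g j * g i)) v = 0.
Proof.
move=> ij; apply/ffunP => x.
rewrite (actionM act_ok (e i * e j)) (actionM act_ok (e i)) !act_e.
rewrite !(actionDl act_ok) !(actionM act_ok) (action1 act_ok) !actg.
rewrite [RHS]ffunE mulrA; case: eqP => [c1|_]; last by rewrite !mul0r.
case: eqP => [c2|_]; last by rewrite mulr0 mul0r.
have DE (w w' : V) : (w + w') x = w x + w' x by rewrite ffunE.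
by rewrite !mul1r !DE; apply: op_g_symmetrizer.
Qed.

Lemma act_proj (c' : {rmorphism A -> B}) psi v : c' =1 c ->
  act (proj c' z dinv t psi) v = restrict_colour psi v.
Proof.
move=> cE; have act1 j a w (x : words) : act (proj1 c' z dinv t j a) w x = ((x j).1 == a)%:R * w x.
  rewrite /proj1 (actionM act_ok) cE actc (action_sum act_ok).
  rewrite -(root_orthogonality dinvd zd orth) ffunE sum_ffunE -[RHS]mulrA.
  rewrite /GRing.scale /= mulr_suml; congr (_ * _); apply: eq_bigr => s _.
  by rewrite (actionM act_ok) cE actc ffunE acttX iter_op_t /GRing.scale /= mulrA -exprD addnC.
rewrite /proj (action_prod act_ok); apply/ffunP => x; rewrite ffunE.
transitivity ((all (fun k => (x k).1 == psi k) (index_enum 'I_n))%:R * v x).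
  elim: (index_enum _) => [|k r IHr] /=; first by rewrite mul1r.
  by rewrite act1 IHr mulrA -natrM mulnb.
have -> : all (fun k => (x k).1 == psi k) (index_enum 'I_n) = [forall k, (x k).1 == psi k].
  apply/allP/forallP => [h k|h k _]; last exact: h.
  exact: h (mem_index_enum k).
by case: ifP => _; rewrite ?mul1r ?mul0r.
Qed.
End TensorAction.

Section FTLAction.
Variables (C : numFieldType) (d n : nat) (zeta : C).
Hypotheses (d_gt0 : (0 < d)%N) (prim : d.-primitive_root zeta).

Local Notation A := (laurent C).
Local Notation V := {ffun {ffun 'I_n -> 'I_d * bool} -> A^o}.
Local Notation q := (laurent_q C).
Local Notation z := (laurent_const zeta).

Definition gen_op (s : 'I_n.-1 + 'I_n) : {linear V -> V} :=
  match s with inl i => op_g q i | inr j => op_t z j end.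

Lemma free_tensor_action :
  tensor_action q z (@free_action A _ V gen_op : yhFree C n -> V -> V)
    (@free_c C n) (@free_g C n) (@free_t C n).
Proof.
split=> [|a v|i v|j v]; first exact: free_action_action.
- exact: free_action_scalar.
- exact: free_action_gen.
- exact: free_action_gen.
Qed.

Lemma ftl_action : exists act : FTL C d n -> V -> V,
  tensor_action q z act (ftl_c d n) (@ftl_g C d n) (@ftl_t C d n).
Proof.
have [dinvd zd orth] := And3 (laurent_dinv C d_gt0) (laurent_root prim) (laurent_orthogonality prim).
have P0 := free_tensor_action; have [ok0 _ _ _] := P0.
have kill0 s : @yh_rel C d n s -> forall v, free_action gen_op s v = 0.
  case=> {s} [i j ij|i j ij|i j|i j|j|i] v; rewrite (actionBl ok0); apply/eqP; rewrite subr_eq0; apply/eqP.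
  - exact: (act_gg P0).
  - exact: (act_braid P0).
  - exact: (act_tt P0).
  - exact: (act_tg P0).
  - exact: (act_td zd P0).
  - exact: (act_quad dinvd zd orth P0).
have [act1 [ok1 E1]] := action_quot ok0 kill0.
have P1 : tensor_action q z act1 (@yh_c C d n) (@yh_g C d n) (@yh_t C d n).
  have [_ c0 g0 t0] := P0.
  by split=> // *; rewrite E1 ?c0 ?g0 ?t0.
have kill1 s : @ftl_rel C d n s -> forall v, act1 s v = 0.
  case=> i j i0 j1 v; apply: (act_symmetrizer dinvd zd orth P1).
  by rewrite i0 j1.
have [act2 [ok2 E2]] := action_quot ok1 kill1.
exists act2; have [_ c1 g1 t1] := P1.
by split=> // *; rewrite E2 ?c1 ?g1 ?t1.
Qed.
End FTLAction.

(** * Extension of scalars and the dimension *)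

Section TensorProduct.
Variables (A K : comNzRingType) (f : {rmorphism A -> K}) (M : lmodType A).
Local Notation Z := {malg int[(K * M)%type]}.

Definition pure (k : K) (m : M) : tensor f M := tensor_pi f (<< (k, m) >> : Z).

Section Lift.
Variables (W : lmodType K) (phi : M -> W).
Hypothesis phiD : forall m m', phi (m + m') = phi m + phi m'.
Hypothesis phiZ : forall a m, phi (a *: m) = f a *: phi m.

Definition lift_fun (x : Z) : W := \sum_(p <- msupp x) (p.1 *: phi p.2) *~ x@_p.

Lemma lift_funEw (E : {fset (K * M)%type}) (x : Z) : (msupp x `<=` E)%fset ->
  lift_fun x = \sum_(p <- E) (p.1 *: phi p.2) *~ x@_p.
Proof.
move=> le; rewrite [LHS](big_fset_incl _ le) //= => p _ /mcoeff_outdom ->.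
by rewrite mulr0z.
Qed.

Fact lift_fun_is_zmod_morphism : zmod_morphism lift_fun.
Proof.
move=> x y; pose E := (msupp x `|` (msupp y `|` msupp (x - y)))%fset.
rewrite !(@lift_funEw E) ?fsubsetUl //; first last.
- by apply: fsubset_trans (fsubsetUr _ _); apply: fsubsetUr.
- by apply: fsubset_trans (fsubsetUr _ _); apply: fsubsetUl.
by rewrite -sumrB; apply: eq_bigr => p _; rewrite mcoeffB mulrzBr.
Qed.

HB.instance Definition _ := GRing.isZmodMorphism.Build Z W lift_fun lift_fun_is_zmod_morphism.

Lemma lift_funU (a : int) p : lift_fun << a *g p >> = (p.1 *: phi p.2) *~ a.
Proof. by rewrite (@lift_funEw [fset p]%fset) ?msuppU_le // big_seq_fset1 mcoeffUU. Qed.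

Lemma lift_fun_rel x : tensor_rel f x -> lift_fun x = 0.
Proof.
elim=> {x} [k k' m|k m m'|k a m||x y _ Ix _ Iy].
- by rewrite raddfB raddfD /= !lift_funU /= !mulr1z scalerDl subrr.
- by rewrite raddfB raddfD /= !lift_funU /= !mulr1z phiD scalerDr subrr.
- by rewrite raddfB /= !lift_funU /= !mulr1z phiZ scalerA subrr.
- exact: raddf0.
- by rewrite raddfB /= Ix Iy subrr.
Qed.

Lemma lift_fun_act c (x : Z) : lift_fun (tensor_act c x) = c *: lift_fun x.
Proof.
rewrite [x]monalgE (raddf_sum (tensor_act c)) !(raddf_sum lift_fun) scaler_sumr.
apply: eq_bigr => p _; rewrite /= tensor_actU !lift_funU /= -scalerA.
by rewrite -scalerMzr.
Qed.

(** This universal property provides the lower bound on the dimension, [tensor_span] the upper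
    one. *)
Lemma tensor_lift : exists Phi : tensor f M -> W,
  linear Phi /\ forall k m, Phi (pure k m) = k *: phi m.
Proof.
pose Phi (u : tensor f M) := lift_fun (repr (u : Quotient.quot (tensor_pred f (M := M)))).
have PhiE x : Phi (tensor_pi f x) = lift_fun x.
  apply/eqP; rewrite -subr_eq0 -raddfB; apply/eqP/lift_fun_rel/tensor_eqP.
  exact: reprK.
exists Phi; split=> [c u v|k m]; last by rewrite PhiE lift_funU mulr1z.
have [x <-] := tensor_surj u; have [y <-] := tensor_surj v.
rewrite -[c *: _]tensor_piZ_def -tensor_piD !PhiE raddfD.
by rewrite [X in X + _]lift_fun_act.
Qed.
End Lift.

Lemma pureDr k m m' : pure k (m + m') = pure k m + pure k m'.
Proof. by rewrite /pure -tensor_piD; apply/tensor_eqP; apply: Tensor_addr. Qed.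

Lemma pureZ c k m : pure (c * k) m = c *: pure k m.
Proof. by rewrite -[RHS]tensor_piZ_def tensor_actU. Qed.

Lemma pure_bal k a m : pure (k * f a) m = pure k (a *: m).
Proof. by apply/tensor_eqP; apply: Tensor_bal. Qed.

Lemma tensor_span (I : finType) (b : I -> M) :
    (forall m, exists a : I -> A, m = \sum_i a i *: b i) ->
  forall u : tensor f M, exists c : I -> K, u = \sum_i c i *: pure 1 (b i).
Proof.
move=> spanM u.
pose S (u : tensor f M) := exists c : I -> K, u = \sum_i c i *: pure 1 (b i).
have S0 : S 0 by exists (fun=> 0); rewrite big1 // => i _; rewrite scale0r.
have SD x y : S x -> S y -> S (x + y).
  move=> [c ->] [c' ->]; exists (fun i => c i + c' i).
  by rewrite -big_split; apply: eq_bigr => i _; rewrite scalerDl.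
have SZ k x : S x -> S (k *: x).
  move=> [c ->]; exists (fun i => k * c i); rewrite scaler_sumr.
  by apply: eq_bigr => i _; rewrite scalerA.
have Spure k m : S (pure k m).
  have pure0 : pure k 0 = 0 by apply: (addIr (pure k 0)); rewrite -pureDr !add0r.
  have pure_sum (r : seq I) (F : I -> M) : pure k (\sum_(i <- r) F i) = \sum_(i <- r) pure k (F i).
    by elim: r => [|i r IHr]; rewrite ?big_nil // !big_cons pureDr IHr.
  have [a ->] := spanM m; exists (fun i => k * f (a i)); rewrite pure_sum.
  by apply: eq_bigr => i _; rewrite -pure_bal -pureZ mulr1.
have [x <-] := tensor_surj u; rewrite [x]monalgE.
elim: (msupp x : seq _) => [|p r IHr].
  by rewrite big_nil; have -> : tensor_pi f (0 : Z) = 0 by exact: (raddf0 (\pi_(Quotient.quot (tensor_pred f (M := M))))%qT).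
rewrite big_cons tensor_piD; apply: SD => //.
have -> : (<< x@_p *g p >> : Z) = << p >> *~ x@_p by rewrite -raddfMz /= intz.
have -> : tensor_pi f (<< p >> *~ x@_p : Z) = tensor_pi f << p >> *~ x@_p.
  exact: (raddfMz (\pi_(Quotient.quot (tensor_pred f (M := M))))%qT).
by rewrite -scaler_int; apply: SZ; case: p => k m; apply: Spure.
Qed.
End TensorProduct.

(** * Matrix coefficients and independence *)

Section Coefficients.
Variables d n : nat.
Local Notation words := {ffun 'I_n -> 'I_d * bool}.
Local Notation pairs := ({ffun 'I_n -> 'I_d} * 'S_n)%type.
Implicit Types (R : comNzRingType) (x : words) (p : pairs).

Definition op_belt R (q : R) p (v : {ffun words -> R^o}) : {ffun words -> R^o} :=
  foldr (op_g q) (restrict_colour p.1 v) (reduced_word p.2).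

Definition source p : words := source_label p.1 p.2.
Definition target p : words := [ffun k => source p (p.2^-1%g k)].
Definition delta R x : {ffun words -> R^o} := [ffun y => (y == x)%:R : R^o].

(** The pair [p] supplies the two test words and indexes the row; [p'] is the spanning element being
    tested and indexes the column. *)
Definition coefficient R (q : R) p p' : R := op_belt q p' (delta R (target p)) (source p).

Lemma coefficient_rmorph R R' (h : {rmorphism R -> R'}) q p p' :
  h (coefficient q p p') = coefficient (h q) p p'.
Proof.
rewrite /coefficient /op_belt; elim: (reduced_word _) (source p) => [|i r IHr] x /=.
  by rewrite !ffunE; case: ifP => _; rewrite ?rmorph0 ?rmorph_nat.
by rewrite ![op_g _ _ _ _]ffunE rmorph_local_op !IHr.
Qed.

(** By [local_op1] each letter of the reduced word contributes a sign and a swap of positions, and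
    the swaps compose to the permutation [p.2]. *)
Lemma op_belt1 R p (v : {ffun words -> R^o}) x :
  op_belt 1 p v x = (-1) ^+ size (reduced_word p.2) *
    restrict_colour p.1 v [ffun k => x (p.2^-1%g k)].
Proof.
case: p => psi u; rewrite /op_belt /=; elim/reduced_word_ind: u x => [|u i di -> IHu] x.
  rewrite /reduced_word; have [[_ e]|[i [+ _]]] := reduced_wordP (1%g : 'S_n).
    rewrite -/(reduced_word _) e mul1r; congr (restrict_colour _ _ _).
    by apply/ffunP => k; rewrite ffunE invg1 perm1.
  by rewrite !perm1 ltnNge ltnW.
rewrite /= ffunE local_op1; last first.
  move=> e; congr (_ _); apply/ffunP => k; rewrite ffunE /adj.
  by case: tpermP => [->|->|].
rewrite IHu exprS mulN1r mulNr; congr (- (_ * restrict_colour _ _ _)).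
apply/ffunP => k; rewrite !ffunE; congr (x _).
by rewrite invMg permM /adj tpermV -/(adj i) adjK.
Qed.

Lemma target_colour p k : (target p k).1 = p.1 k.
Proof. by rewrite !ffunE /= permKV. Qed.

Lemma coefficient1_diag R p : coefficient (1 : R) p p != 0.
Proof.
rewrite /coefficient op_belt1 ffunE -/(target p).
have -> : [forall k, ((target p) k).1 == p.1 k] by apply/forallP => k; rewrite target_colour.
by rewrite ffunE eqxx mulr1 signr_eq0.
Qed.

(** A nonzero entry forces equal colourings and says that [p'.2] carries the labels of [p] to where
    [p.2] sends them, which is the hypothesis of [triangularity]. *)
Lemma coefficient1_triangular R p p' : good p.1 p.2 -> good p'.1 p'.2 ->
    coefficient (1 : R) p p' != 0 ->
  p = p' \/ (weight_excess p.1 p.2 < weight_excess p'.1 p'.2)%N.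
Proof.
case: p p' => psi u [psi' v] /= gu gv.
rewrite /coefficient op_belt1 ffunE /=; case: ifP => [/forallP col|_]; last by rewrite mulr0 eqxx.
rewrite ffunE; case: (_ =P target _) => [E _|_]; last by rewrite mulr0 eqxx.
have epsi : psi' = psi.
  by apply/ffunP => k; have := col k; rewrite E target_colour => /eqP->.
subst psi'; have E' : source_label psi u \o u^-1%g =1 source_label psi u \o v^-1%g.
  by move=> k; have /ffunP/(_ k) := E; rewrite /= !ffunE /= => ->.
by have [->|] := triangularity gu gv E'; [left|right].
Qed.
End Coefficients.

Section Dimension.
Variables (C : numFieldType) (d n : nat) (zeta : C).
Hypotheses (d_gt0 : (0 < d)%N) (prim : d.-primitive_root zeta).

Local Notation A := (laurent C).
Local Notation F := (ratfun C).
Local Notation words := {ffun 'I_n -> 'I_d * bool}.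
Local Notation pairs := ({ffun 'I_n -> 'I_d} * 'S_n)%type.

Definition good_pairs : {set pairs} := [set p : pairs | good p.1 p.2].
Local Notation N := #|good_pairs|.

Definition coefficient_mx (R : comNzRingType) (q : R) : 'M[R]_N :=
  \matrix_(i, j) coefficient q (enum_val i) (enum_val j).

Lemma enum_good (i : 'I_N) : good (enum_val i).1 (enum_val i).2.
Proof. by have := enum_valP i; rewrite inE. Qed.

(** Triangularity is used without ordering the indices: for a vector in the left kernel, an index of
    least [weight_excess] in its support gives a column in which only the diagonal entry can
    contribute. *)
Lemma det_coefficient_mx1 : \det (coefficient_mx (1 : C)) != 0.
Proof.
apply/negP => /det0P[v v0 vM].
have [i0 vi0] : exists i, v 0 i != 0.
  by apply/existsP; rewrite -negb_forall; apply: contra v0 => /forallP h;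
     apply/eqP/rowP => i; rewrite mxE; apply/eqP/h.
pose mu (i : 'I_N) := weight_excess (enum_val i).1 (enum_val i).2.
case: (arg_minnP mu (vi0 : (fun i => v 0 i != 0) i0)) => i vi min_i.
have /rowP/(_ i) := vM; rewrite !mxE (bigD1 i) //= big1 => [|j ji].
  rewrite addr0 mxE => /eqP; rewrite mulf_eq0 (negPf vi) /=; apply/negP.
  exact: coefficient1_diag.
rewrite mxE; have [->|cji] := eqVneq (coefficient (1 : C) (enum_val j) (enum_val i)) 0; first by rewrite mulr0.
have [/enum_val_inj e|lt] := coefficient1_triangular (enum_good j) (enum_good i) cji.
  by rewrite e eqxx in ji.
have [->|vj] := eqVneq (v 0 j) 0; first by rewrite mul0r.
by have := min_i _ vj; rewrite leqNgt lt.
Qed.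

(** The matrix over [{poly C}] at ['X] maps both to the one over [ratfun C] and, by evaluation at 1,
    to the one at [q = 1]; its determinant is a nonzero polynomial because its value at 1 is
    nonzero. *)
Lemma coefficient_mx_unit : coefficient_mx (ratfun_of_poly 'X : F) \in unitmx.
Proof.
have E (R R' : comNzRingType) (h : {rmorphism R -> R'}) q :
    map_mx h (coefficient_mx q) = coefficient_mx (h q).
  by apply/matrixP => i j; rewrite !mxE coefficient_rmorph.
rewrite unitmxE unitfE -(E _ _ (@ratfun_of_poly C) 'X) det_map_mx ratfun_of_poly_eq0.
apply: contra_neq det_coefficient_mx1 => det0.
have -> : (1 : C) = horner_eval 1 'X by rewrite /horner_eval hornerX.
by rewrite -(E _ _ (horner_eval 1) 'X) det_map_mx det0 rmorph0.
Qed.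

Lemma act_belt act : tensor_action (laurent_q C) (laurent_const zeta) act
    (ftl_c d n) (@ftl_g C d n) (@ftl_t C d n) ->
  forall p v, act (ftl_belt zeta p.1 p.2) v = op_belt (laurent_q C) p v.
Proof.
move=> P [psi u] v; have [ok _ actg _] := P; rewrite /ftl_belt /belt /stdelt /op_belt /=.
rewrite (actionM ok) (action_prod ok) (act_proj (laurent_dinv C d_gt0) (laurent_root prim)
  (laurent_orthogonality prim) P) //.
by elim: (reduced_word u) => //= i r ->; rewrite actg.
Qed.

Lemma ftl_has_dim : has_dim (FTLq C d n) N.
Proof.
have [act P] := ftl_action n d_gt0 prim; have [act_ok actc _ _] := P.
pose b (j : 'I_N) : FTL C d n := ftl_belt zeta (enum_val j).1 (enum_val j).2.
pose x (i : 'I_N) := source (enum_val i); pose y (i : 'I_N) := target (enum_val i).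
(* Of the whole action only one matrix entry is kept for each member of the family, so the target
   has dimension [N]. *)
pose phi (m : FTL C d n) : 'rV[F]_N := \row_i \val (act m (delta A (y i)) (x i) : A).
have phiD m m' : phi (m + m') = phi m + phi m'.
  by apply/rowP => i; rewrite !mxE (actionDl act_ok) ffunE rmorphD.
have phiZ a m : phi (a *: m) = \val a *: phi m.
  apply/rowP => i; rewrite !mxE -rmorphM; congr (\val _).
  by rewrite -[a *: m]/(ftl_c d n a * m) (actionM act_ok) actc ffunE.
have phib j i : phi (b j) 0 i = coefficient_mx (ratfun_of_poly 'X : F) i j.
  by rewrite !mxE (act_belt P) -[in RHS]val_laurent_of_poly -coefficient_rmorph.
have [Phi [PhiL PhiE]] := tensor_lift phiD phiZ.
pose beta j : FTLq C d n := pure _ 1 (b j).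
have span (u : FTLq C d n) : exists c : 'rV[F]_N, u = \sum_j c 0 j *: beta j.
  have [m|c ->] := tensor_span (b := b) _ u.
    have : lspan (ftl_c d n) (fun y => exists j, y = b j) m.
      refine (span_trans (@ftl_c_central C d n) _ (ftl_span d_gt0 prim m)).
      move=> _ [psi [w [gw ->]]]; have Gw : (psi, w) \in good_pairs by rewrite inE.
      apply: span_gen; exists (enum_rank_in Gw (psi, w)).
      by rewrite /b enum_rankK_in.
    by move/span_family.
  by exists (\row_j c j); apply: eq_bigr => j _; rewrite mxE.
pose M := coefficient_mx (ratfun_of_poly 'X : F).
pose L : {linear FTLq C d n -> 'rV[F]_N} := HB.pack Phi (GRing.isLinear.Build _ _ _ _ Phi PhiL).
have PhiS (c : 'rV[F]_N) : Phi (\sum_j c 0 j *: beta j) = c *m M^T.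
  rewrite -[Phi]/(L : _ -> _) linear_sum; apply/rowP => i; rewrite !mxE summxE.
  by apply: eq_bigr => j _; rewrite linearZ /= PhiE scale1r [LHS]mxE phib [M^T _ _]mxE.
have Mu : M^T \in unitmx by rewrite unitmx_tr coefficient_mx_unit.
(* On the spanning family [Phi] is given by an invertible matrix, so the coordinates of an element
   can be recovered from its image and [Phi] is bijective. *)
constructor; exists Phi => //.
exists (fun v => \sum_j (v *m invmx M^T) 0 j *: beta j) => [u|v]; last by rewrite PhiS mulmxKV.
by have [c ->] := span u; rewrite PhiS mulmxK.
Qed.
End Dimension.

(** In characteristic zero X^d - 1 is separable, so a closed field contains [d] distinct d-th roots
    of unity, and one of them is then primitive. *)
Lemma prim_root_exists (F : numClosedFieldType) (d : nat) : (0 < d)%N ->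
  exists zeta : F, d.-primitive_root zeta.
Proof.
move=> d_gt0; have [r Er] := closed_field_poly_normal ('X^d - 1 : {poly F}).
rewrite (monicP _) ?monicXnsubC // scale1r in Er.
have roots : all d.-unity_root r by apply/allP => z; rewrite -root_prod_XsubC -Er.
have uniq_r : uniq r.
  by rewrite -separable_prod_XsubC -Er separable_Xn_sub_1 // pnatr_eq0 -lt0n.
have size_r : (d <= size r)%N by rewrite -ltnS -(size_prod_XsubC r id) -Er size_XnsubC.
by have /hasP[z _ prim] := has_prim_root d_gt0 roots uniq_r size_r; exists z.
Qed.

Local Open Scope nat_scope.

Theorem theorem3p11 (R : realType) (d n : nat) (hd : 0 < d) (hn : 0 < n) :
  has_dim (FTLq R[i] d n)
    (\sum_(mu in Comp d n) multinomial mu ^ 2 * \prod_(i < d) catalan (mu i)).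
Proof.
have [zeta prim] := prim_root_exists R[i] hd.
by rewrite -card_good_pairs; apply: (ftl_has_dim n hd prim).
Qed.
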